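(* Let $\mu\subset\lambda$ be partitions and $n$ a positive integer. The map \[ \phi_{\mathrm{vsort}}:\mathrm{LHT}^*_n(\lambda/\mu)\to\mathrm{SSCT}^*_n(\lambda/\mu) \] is a weight-preserving bijection (i.e. $\mathrm{wt}^*(\phi_{\mathrm{vsort}}(L))=\mathrm{wt}^*(L)$ for all $L\in \mathrm{LHT}^*_n(\lambda/\mu)$) whose inverse is \[ \phi_{\mathrm{msort}}:\mathrm{SSCT}^*_n(\lambda/\mu)\to\mathrm{LHT}^*_n(\lambda/\mu). \]
   Context: $\mathbb N=\{0,1,2,\dots\}$. Partitions are identified with Young diagrams (sets of cells $(i,j)$, row $i$, column $j$); a skew shape $\lambda/\mu$ is the set difference of diagrams $\mu\subset\lambda$. A marked tableau of a skew shape $\alpha$ is a map $T:\alpha\to\mathbb N\times(\mathbb N\cup\{\infty\})$; $T(i,j)=(a,r)$ is written $a_r$, where $a$ is the value and $r$ the mark. $T|_\alpha$ denotes restriction to the cells in $\alpha$ (cells keep their coordinates). With variables $x_0,x_1,\dots$ and $y_0,y_1,\dots$, $\mathrm{wt}^*(T)$ is the product over all cells of $x_b$ if $T(i,j)=a_b$ with $b\ne\infty$, and $y_a$ if $T(i,j)=a_\infty$. $\mathrm{LHT}^*_n(\alpha)$ (extended $n$-lecture hall tableaux): marked tableaux $T$ of shape $\alpha$ such that (1) if $T(i,j)=a_r$ then $0\le a<n+j-i$; (2) if $(i,j),(i,j+1)\in\alpha$, $T(i,j)=a_r$, $T(i,j+1)=b_s$, then $r>s$, or $r=s$ and $a\ge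 b$; (3) if $(i,j),(i+1,j)\in\alpha$, $T(i,j)=a_r$, $T(i+1,j)=b_s$, then $r>s$, or $r=s$ and $a>b$. $\mathrm{SSCT}^*_n(\alpha)$ (marked semistandard $n$-content tableaux): marked tableaux of shape $\alpha$ (arbitrary marks) whose values are weakly decreasing along rows, strictly decreasing down columns, and satisfy $0\le a<n-i+j$ for the value $a$ in cell $(i,j)$. Tail: for $L\in\mathrm{LHT}^*_n(\alpha)$ let $r$ be the smallest mark and $a$ the smallest value with mark $r$; $\mathrm{tail}(L)$ is the rightmost cell with $L(i,j)=a_r$. Head: for $S\in\mathrm{SSCT}^*_n(\beta)$ let $r$ be the largest mark and $a$ the largest value with mark $r$; $\mathrm{head}(S)$ is the leftmost cell with $S(i,j)=a_r$. Value-jdt $\phi_{\mathrm{vjdt}}(P,u)=(Q,v)$ (input: marked tableau $P$ of shape $\lambda/\mu$ and a cell $u$). Start with $Q=P$, $v=u$ (the active cell). Repeat: let $(i,j)=v$, $a_r=Q(i,j)$, $b_s=Q(i,j+1)$, $c_t=Q(i+1,j)$, where $b_s$ (resp. $c_t$) is set to $(-1)_0$ if $(i,j+1)$ (resp. $(i+1,j)$) is not in $\lambda/\mu$. If $a\ge b$ and $a>c$, stop and output $(Q,v)$. Otherwise: if $b-1>c$, set $Q(i,j)=(b-1)_s$, $Q(i,j+1)=a_r$, $v=(i,j+1)$; if $c+1\ge b$, set $Q(i,j)=(c+1)_t$, $Q(i+1,j)=a_r$, $v=(i+1,j)$. Mark-jdt $\phi_{\mathrm{mjdt}}(Q,v)=(P,u)$.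 Start with $P=Q$, $u=v$. Repeat: let $(i,j)=u$, $a_r=P(i,j)$, $b_s=P(i,j-1)$, $c_t=P(i-1,j)$, where $b_s$ (resp. $c_t$) is set to $\infty_\infty$ if $(i,j-1)$ (resp. $(i-1,j)$) is not in $\lambda/\mu$. If $r\le s$ and $r\le t$, stop and output $(P,u)$. Otherwise: if $t<r\le s$, or $s,t<r$ and $b\ge c-1$, set $P(i,j)=(c-1)_t$, $P(i-1,j)=a_r$, $u=(i-1,j)$; if $s<r\le t$, or $s,t<r$ and $c>b+1$, set $P(i,j)=(b+1)_s$, $P(i,j-1)=a_r$, $u=(i,j-1)$. Put $N=|\lambda/\mu|$ (number of cells). Value-sorting $\phi_{\mathrm{vsort}}(L)$ for $L\in\mathrm{LHT}^*_n(\lambda/\mu)$: set $T_0=L$, $\alpha_0=\lambda/\mu$, $\beta_0=\emptyset$, $u_0=\mathrm{tail}(T_0)$; for $i=1,\dots,N$ set $(T_i,v_i)=\phi_{\mathrm{vjdt}}(T_{i-1},u_{i-1})$, $\alpha_i=\alpha_{i-1}\setminus\{u_{i-1}\}$, $\beta_i=\beta_{i-1}\cup\{u_{i-1}\}$, $u_i=\mathrm{tail}(T_i|_{\alpha_i})$ (the last only when $\alpha_i\neq\emptyset$); output $T_N$. Mark-sorting $\phi_{\mathrm{msort}}(S)$ for $S\in\mathrm{SSCT}^*_n(\lambda/\mu)$: set $T_N=S$, $\alpha_N=\emptyset$, $\beta_N=\lambda/\mu$, $v_N=\mathrm{head}(T_N)$; for $i=N-1,\dots,0$ set $(T_i,u_i)=\phi_{\mathrm{mjdt}}(T_{i+1},v_{i+1})$,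 $\alpha_i=\alpha_{i+1}\cup\{u_i\}$, $\beta_i=\beta_{i+1}\setminus\{u_i\}$, $v_i=\mathrm{head}(T_i|_{\beta_i})$ (the last only when $\beta_i\neq\emptyset$); output $T_0$. *)

(* Defs.v *)
From mathcomp Require Export all_boot all_order all_algebra.
From mathcomp Require Export finmap.
From mathcomp.multinomials Require Export monalg.
From mathcomp Require Import zify.

Set Implicit Arguments.
Unset Strict Implicit.
Unset Printing Implicit Defensive.

Import Order.TTheory GRing.Theory Num.Theory.

Local Open Scope fset_scope.
Local Open Scope fmap_scope.
Local Open Scope nat_scope.

(* Row and column numbers start at 1, so that the left (resp. upper)         *)
(* neighbour of a cell in column (resp. row) 1 has column (resp. row) 0 and  *)
(* lies outside every diagram; no truncation occurs in [j.-1] or [i.-1].     *)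
Definition cell : Type := (nat * nat)%type.

Definition is_partition (la : seq nat) : bool :=
  sorted geq la && all (fun p => 0 < p) la.

Definition diagram (la : seq nat) : {fset cell} :=
  [fset c in [seq (i.+1, j.+1) | i <- iota 0 (size la),
                                 j <- iota 0 (nth 0 la i)]].

Definition skew_shape (la mu : seq nat) : {fset cell} := diagram la `\` diagram mu.

(* N + {oo}; [None] is oo. *)
Definition natoo : Type := option nat.

Definition leoo (x y : natoo) : bool :=
  match x, y with
  | _, None => true
  | None, Some _ => false
  | Some p, Some q => p <= q
  end.

Definition ltoo (x y : natoo) : bool := ~~ leoo y x.

(* The entry a_r is (a, r). *)
Definition entry : Type := (nat * natoo)%type.

(* A tableau of shape alpha is a finite map T with [domf T = alpha]. *)
Definition tableau : Type := {fmap cell -> entry}.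

Definition ent (T : tableau) (c : cell) : entry := odflt (0, None) T.[? c].

Definition LHT (n : nat) (alpha : {fset cell}) (T : tableau) : Prop :=
  [/\ domf T = alpha,
      forall i j a r, T.[? (i, j)] = Some (a, r) ->
        (a%:Z < n%:Z + j%:Z - i%:Z)%R,
      forall i j a r b s,
        T.[? (i, j)] = Some (a, r) -> T.[? (i, j.+1)] = Some (b, s) ->
        ltoo s r \/ r = s /\ b <= a
    & forall i j a r b s,
        T.[? (i, j)] = Some (a, r) -> T.[? (i.+1, j)] = Some (b, s) ->
        ltoo s r \/ r = s /\ b < a].

Definition SSCT (n : nat) (alpha : {fset cell}) (T : tableau) : Prop :=
  [/\ domf T = alpha,
      forall i j a r, T.[? (i, j)] = Some (a, r) ->
        (a%:Z < n%:Z - i%:Z + j%:Z)%R,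
      forall i j a r b s,
        T.[? (i, j)] = Some (a, r) -> T.[? (i, j.+1)] = Some (b, s) -> b <= a
    & forall i j a r b s,
        T.[? (i, j)] = Some (a, r) -> T.[? (i.+1, j)] = Some (b, s) -> b < a].

(* Monomials in x_0, x_1, ..., y_0, y_1, ...: x_b is the variable [inl b],   *)
(* y_a is the variable [inr a].                                              *)
Definition xvar (b : nat) : {cmonom (nat + nat)%type} := ucm (inl b).
Definition yvar (a : nat) : {cmonom (nat + nat)%type} := ucm (inr a).

Definition wt (T : tableau) : {cmonom (nat + nat)%type} :=
  \big[mmul/mone]_(c : domf T)
     (if (T c).2 is Some b then xvar b else yvar (T c).1).

Definition is_tail (T : tableau) (u : cell) : bool :=
  all (fun c => [&& leoo (ent T u).2 (ent T c).2,
                    ((ent T c).2 == (ent T u).2) ==>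
                      ((ent T u).1 <= (ent T c).1)
                  & (ent T c == ent T u) ==> (c.2 <= u.2)]) (domf T).

Definition is_head (T : tableau) (u : cell) : bool :=
  all (fun c => [&& leoo (ent T c).2 (ent T u).2,
                    ((ent T c).2 == (ent T u).2) ==>
                      ((ent T c).1 <= (ent T u).1)
                  & (ent T c == ent T u) ==> (u.2 <= c.2)]) (domf T).

(* The default (0, 0) is only returned for the empty tableau. *)
Definition tail_cell (T : tableau) : cell :=
  head (0, 0) [seq u <- domf T | is_tail T u].

Definition head_cell (T : tableau) : cell :=
  head (0, 0) [seq u <- domf T | is_head T u].

(* One round of the loop of the value-jdt; the stopping states are fixed.    *)
(* The values of the neighbours are integers because an absent neighbour     *)
(* counts as (-1)_0; [b - 1] and [c + 1] are nonnegative where they are      *)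
(* written back into the tableau.                                            *)
Definition vstep (x : tableau * cell) : tableau * cell :=
  let: (Q, (i, j)) := x in
  let nbr d : int * natoo :=
    if Q.[? d] is Some e then ((e.1%:Z)%R, e.2) else ((-1)%R, Some 0) in
  let: (a, r) := ent Q (i, j) in
  let: (b, s) := nbr (i, j.+1) in
  let: (c, t) := nbr (i.+1, j) in
  if ((b <= a%:Z) && (c < a%:Z))%R then x
  else if (c < b - 1)%R then
    (Q.[(i, j) <- (`|(b - 1)%R|%N, s)].[(i, j.+1) <- (a, r)], (i, j.+1))
  else
    (Q.[(i, j) <- (`|(c + 1)%R|%N, t)].[(i.+1, j) <- (a, r)], (i.+1, j)).

(* One round of the loop of the mark-jdt.  An absent neighbour counts as     *)
(* oo_oo; since its mark is oo, its value is never compared nor written.     *)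
(* [c.-1] differs from c - 1 only for c = 0, where the comparison with b is  *)
(* unaffected; in the tableaux met by mark-sorting a value moved down is     *)
(* always positive.                                                          *)
Definition mstep (x : tableau * cell) : tableau * cell :=
  let: (P, (i, j)) := x in
  let nbr d : natoo * natoo :=
    if P.[? d] is Some e then (Some e.1, e.2) else (None, None) in
  let: (a, r) := ent P (i, j) in
  let: (b, s) := nbr (i, j.-1) in
  let: (c, t) := nbr (i.-1, j) in
  if leoo r s && leoo r t then x
  else if ltoo t r && leoo r s
       || [&& ltoo s r, ltoo t r & leoo (omap predn c) b] then
    (P.[(i, j) <- (odflt 0 (omap predn c), t)].[(i.-1, j) <- (a, r)],
     (i.-1, j))
  else
    (P.[(i, j) <- (odflt 0 (omap succn b), s)].[(i, j.-1) <- (a, r)],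
     (i, j.-1)).

(* The active cell travels along a lattice path inside the shape, so the     *)
(* loops stop within #|shape| rounds: see [vjdt_stop] and [mjdt_stop].       *)
Definition vjdt (P : tableau) (u : cell) : tableau * cell :=
  iter #|` domf P| vstep (P, u).

Definition mjdt (Q : tableau) (v : cell) : tableau * cell :=
  iter #|` domf Q| mstep (Q, v).

(* (T_(i-1), alpha_(i-1)) |-> (T_i, alpha_i) *)
Definition vsort_step (x : tableau * {fset cell}) : tableau * {fset cell} :=
  let: (T, alpha) := x in
  let u := tail_cell T.[& alpha] in
  ((vjdt T u).1, alpha `\ u).

Definition vsort (L : tableau) : tableau :=
  (iter #|` domf L| vsort_step (L, domf L)).1.

(* (T_(i+1), beta_(i+1)) |-> (T_i, beta_i) *)
Definition msort_step (x : tableau * {fset cell}) : tableau * {fset cell} :=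
  let: (T, beta) := x in
  let: (T', u) := mjdt T (head_cell T.[& beta]) in
  (T', beta `\ u).

Definition msort (S : tableau) : tableau :=
  (iter #|` domf S| msort_step (S, domf S)).1.

Lemma iter_stop (X : eqType) (f : X -> X) (pos : X -> cell) (lt : rel cell)
    (A : {fset cell}) (inv : X -> Prop) (x : X) :
  irreflexive lt -> transitive lt ->
  (forall y, inv y -> pos y \in A) ->
  (forall y, inv y -> inv (f y) /\ (f y = y \/ lt (pos y) (pos (f y)))) ->
  inv x -> f (iter #|` A| f x) = iter #|` A| f x.
Proof.
move=> irr tr invA invf invx; set N := #|` A|; apply/eqP/negPn/negP=> nstop.
have ik k : inv (iter k f x) by elim: k => //= k /invf [].
have step k : k <= N -> lt (pos (iter k f x)) (pos (iter k.+1 f x)).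
  move=> lekN; have [_ [fixk|//]] := invf _ (ik k); case/eqP: nstop.
  rewrite -(subnK lekN) iterD; suff -> : iter (N - k) f (iter k f x) =
    iter k f x by [].
  by elim: (N - k) => //= m ->.
pose s := [seq pos (iter k f x) | k <- iota 0 N.+1].
have : size s <= size (enum_fset A).
  apply: uniq_leq_size; last by move=> c /mapP[k _ ->]; exact/invA/ik.
  apply: (sorted_uniq tr irr); rewrite /s.
  have: forall m k, m + k <= N.+1 ->
      sorted lt [seq pos (iter l f x) | l <- iota m k].
    move=> m [|k] //= ; elim: k m => //= k IH m h; rewrite step /=; last by lia.
    by apply: IH; lia.
  by apply.
by rewrite size_map size_iota ltnn.
Qed.

Lemma domf_move (Q : tableau) (c d : cell) (e e' : entry) :
  c \in domf Q -> d \in domf Q -> domf Q.[c <- e].[d <- e'] = domf Q.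
Proof.
by move=> cQ dQ; apply/fsetP=> u; rewrite !inE; do 2?case: eqP => [->|_] //=.
Qed.

Lemma fnd_in (Q : tableau) (d : cell) (e : entry) :
  Q.[? d] = Some e -> d \in domf Q.
Proof. by move=> hd; rewrite -fndSome hd. Qed.

Lemma vjdt_stop (P : tableau) (u : cell) :
  u \in domf P -> vstep (vjdt P u) = vjdt P u.
Proof.
move=> uP.
pose lt (c d : cell) := c.1 + c.2 < d.1 + d.2.
apply: (@iter_stop _ vstep snd lt (domf P)
  (fun y => domf y.1 = domf P /\ y.2 \in domf P)) => //.
- by move=> c; rewrite /lt ltnn.
- by move=> c d e; apply: ltn_trans.
- by move=> y [].
move=> [Q [i j]] /= [dQ ijP]; rewrite -dQ in ijP *; rewrite /vstep.
case: (ent Q (i, j)) => a r.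
case hb : Q.[? (i, j.+1)] => [[b s]|]; case hc : Q.[? (i.+1, j)] => [[c t]|].
- case: ifP => h1; first by split; [split|left].
  case: ifP => h2; rewrite domf_move ?(fnd_in hb) ?(fnd_in hc) //;
    by split=> //; right; rewrite /lt /=; lia.
- case: ifP => h1; first by split; [split|left].
  case: ifP => h2; last by exfalso; lia.
  by rewrite domf_move ?(fnd_in hb) //; split=> //; right; rewrite /lt /=; lia.
- case: ifP => h1; first by split; [split|left].
  by rewrite domf_move ?(fnd_in hc) //; split=> //; right; rewrite /lt /=; lia.
- by split; [split|left].
Qed.

Lemma mjdt_stop (Q : tableau) (v : cell) :
  v \in domf Q -> mstep (mjdt Q v) = mjdt Q v.
Proof.
move=> vQ.
pose lt (c d : cell) := d.1 + d.2 < c.1 + c.2.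
apply: (@iter_stop _ mstep snd lt (domf Q)
  (fun y => domf y.1 = domf Q /\ y.2 \in domf Q)) => //.
- by move=> c; rewrite /lt ltnn.
- by move=> c d e h1 h2; apply: ltn_trans h2 h1.
- by move=> y [].
move=> [P [i j]] /= [dP ijQ]; rewrite -dP in ijQ *; rewrite /mstep.
case ha : (ent P (i, j)) => [a r].
have fP : P.[? (i, j)] = Some (a, r).
  by move: ha; rewrite /ent; case: fndP ijQ => //= ? _ ->.
have leoo_refl : leoo r r by case: (r) => /=.
have hi b s : P.[? (i.-1, j)] = Some (b, s) -> ~~ leoo r s -> 0 < i.
  by case: (i) fP => //= -> [_ <-]; rewrite leoo_refl.
have hj b s : P.[? (i, j.-1)] = Some (b, s) -> ~~ leoo r s -> 0 < j.
  by case: (j) fP => //= -> [_ <-]; rewrite leoo_refl.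
have leooN x : leoo x None by case: x.
case hb : P.[? (i, j.-1)] => [[b s]|]; case hc : P.[? (i.-1, j)] => [[c t]|] /=;
  rewrite /ltoo ?leooN ?andbT ?andbF ?orbF /=.
- case: ifP => h1; first by split; [split|left].
  case: ifP => h2.
  + have i0 : 0 < i by apply: (hi _ _ hc); move: h2; case: (leoo r t); rewrite ?andbF.
    by rewrite domf_move ?(fnd_in hc) //; split=> //; right; rewrite /lt /=; lia.
  + have j0 : 0 < j.
      apply: (hj _ _ hb); move: h1 h2.
      by case: (leoo r s); case: (leoo r t).
    by rewrite domf_move ?(fnd_in hb) //; split=> //; right; rewrite /lt /=; lia.
- case: ifP => h1; first by split; [split|left].
  have j0 : 0 < j by apply: (hj _ _ hb); rewrite h1.
  by rewrite domf_move ?(fnd_in hb) //; split=> //; right; rewrite /lt /=; lia.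
- case: ifP => h1; first by split; [split|left].
  have i0 : 0 < i by apply: (hi _ _ hc); rewrite h1.
  by rewrite h1 domf_move ?(fnd_in hc) //; split=> //; right; rewrite /lt /=; lia.
- by split; [split|left].
Qed.

(* Main.v *)
Require Import Defs.
From mathcomp Require Import zify.

Set Implicit Arguments.
Unset Strict Implicit.
Unset Printing Implicit Defensive.

Import Order.TTheory GRing.Theory Num.Theory.
Local Open Scope fset_scope.
Local Open Scope fmap_scope.
Local Open Scope nat_scope.

#[local] Arguments vstep : simpl never.
#[local] Arguments mstep : simpl never.

(** Call alpha the set of cells still to be sorted and beta its complement.
  Value-sorting turns a tableau satisfying the lecture hall conditions into one
  satisfying the content conditions by moving one cell at a time from alpha to
  beta; between two moves the tableau is lecture hall on alpha, a content
  tableau on beta, and every entry of beta is at most every entry of alpha when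
  entries are compared first by mark and then by value.  Mark-sorting goes
  through the same states ([sort_state]) in the opposite direction, so it is
  enough to show that one step of each undoes one step of the other.

  The two jeux de taquin become transparent after the change of variable
  [cvalue], value + row - column.  A content tableau is one where the shifted
  values decrease weakly down columns and strictly along rows, the bound on the
  values reads [cvalue < n], and the corrections b - 1, c + 1 of the value-jdt
  and c - 1, b + 1 of the mark-jdt are precisely those that leave the shifted
  value of the displaced entry unchanged.  Both algorithms are thus ordinary
  slides of the shifted values; only the active entry keeps its true value.
  One invariant [ssct_but], where only comparisons of the active cell with the
  cells to its right and below are given up, is kept by both ([ssct_but_rt],
  [ssct_but_dn], [ssct_but_lf], [ssct_but_up]), and each slide undoes the other
  ([vstep_undone], [mstep_undone]) as long as the entries that are passed have
  a mark strictly below that of the active entry.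

  What remains is to see that the inserted entry becomes the head of beta, and
  that the extracted one becomes the tail of alpha.  This is immediate unless
  the tail u and the head v carry the same entry.  In that case forward moves
  need the value-jdt path from u to end strictly left of v ([ends_apart]),
  backward moves need u to be strictly left of the end of the mark-jdt path
  from v ([starts_apart]).  These two conditions are equivalent
  ([ends_starts_apart]): the forward path leaving (i, j-1) and the backward
  path leaving (i+1, j) both compare the cells (i, j) and (i+1, j-1), and they
  choose different ones, so the two paths cannot cross ([cross_left],
  [cross_right]).  After a step one of the conditions is evident and provides
  the other, and the induction goes on.

  The weight is preserved because a passed entry has a mark below another mark,
  hence a finite one, and the weight of such an entry ignores its value. *)

(** Linear arithmetic on coordinates and values; membership facts only slow
    it down. *)
Ltac nat_lia :=
  repeat match goal with
  | H : context [in_mem _ _] |- _ => clear H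
  | H : context [@eq_op _ _ _] |- _ => clear H
  end; lia.

(** * Cells, entries and single slides *)

Definition cell_le (c d : cell) : bool := (c.1 <= d.1) && (c.2 <= d.2).

Definition rt (c : cell) : cell := (c.1, c.2.+1).
Definition dn (c : cell) : cell := (c.1.+1, c.2).
Definition lf (c : cell) : cell := (c.1, c.2.-1).
Definition up (c : cell) : cell := (c.1.-1, c.2).

(** The lexicographic order by mark, then by value. A tableau is lecture hall
    when entries weakly decrease along rows and strictly decrease down columns
    for this order. *)
Definition entry_le (e f : entry) : bool :=
  leoo e.2 f.2 && ((e.2 == f.2) ==> (e.1 <= f.1)).

(** Both loops change a tableau in this way only; h is the active cell before
    the move and y the active cell after it. *)
Definition slide (Q : tableau) (h y : cell) (k : nat) : tableau :=
  Q.[h <- (k, (ent Q y).2)].[y <- ent Q h].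

(** The value minus the content of the cell. Slides keep this number for the
    displaced entry, and the bound of both families of tableaux says that it is
    less than n. *)
Definition cvalue (T : tableau) (c : cell) : int :=
  ((ent T c).1%:Z + c.1%:Z - c.2%:Z)%R.

(** In terms of shifted values, rows are strict and columns are weak. The
    relation is used for all comparable cells, which makes its preservation by
    slides a matter of transitivity. *)
Definition ssct_rel (f : cell -> int) (c d : cell) : Prop :=
  (f d <= f c)%R /\ (c.2 < d.2 -> (f d < f c)%R).

Lemma cell_neq (c d : cell) : c != d -> (c.1 != d.1) || (c.2 != d.2).
Proof. by case: c d => [i j] [k l]; rewrite xpair_eqE negb_and. Qed.

Lemma ent_slide Q h y k x :
  ent (slide Q h y k) x =
    if x == y then ent Q h else if x == h then (k, (ent Q y).2) else ent Q x.
Proof. by rewrite /ent /slide !fnd_set; case: eqP => // _; case: eqP. Qed.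

Lemma ent_fnd (Q : tableau) c : c \in domf Q -> Q.[? c] = Some (ent Q c).
Proof. by rewrite /ent; case: fndP. Qed.

Lemma notin_fnd (Q : tableau) c : c \notin domf Q -> Q.[? c] = None.
Proof. exact: not_fnd. Qed.

Lemma tab_ext (P Q : tableau) : domf P = domf Q ->
  (forall c, c \in domf P -> ent P c = ent Q c) -> P = Q.
Proof.
move=> dPQ ePQ; apply/fmapP=> c; have [cP|cP] := boolP (c \in domf P).
  by rewrite !ent_fnd -?dPQ // ePQ.
by rewrite !notin_fnd -?dPQ.
Qed.

Lemma slideK Q h y k : h \in domf Q -> y \in domf Q -> h != y ->
  slide (slide Q h y k) y h (ent Q y).1 = Q.
Proof.
move=> hQ yQ hy; have d1 : domf (slide Q h y k) = domf Q by apply: domf_move.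
apply: tab_ext; first by rewrite domf_move d1.
move=> c _; rewrite !ent_slide !eqxx (negPf hy) /=.
by case: eqP => [->|_] //; case: eqP => [->|//]; case: (ent Q y).
Qed.

Lemma leooxx r : leoo r r. Proof. by case: r => /=. Qed.
Lemma leoo_total r s : leoo r s || leoo s r.
Proof. by case: r s => [p|] [q|] //=; exact: leq_total. Qed.
Lemma leoo_anti r s : leoo r s -> leoo s r -> r = s.
Proof. by case: r s => [p|] [q|] //= h1 h2; congr Some; lia. Qed.
Lemma leoo_trans r s t : leoo r s -> leoo s t -> leoo r t.
Proof. by case: r s t => [p|] [q|] [o|] //=; exact: leq_trans. Qed.

Lemma entry_lexx e : entry_le e e.
Proof. by rewrite /entry_le leooxx leqnn implybT. Qed.
Lemma entry_le_total e f : entry_le e f || entry_le f e.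
Proof.
case: e f => [a r] [b s]; rewrite /entry_le /= [s == r]eq_sym.
have := leoo_total r s; case: eqP => [->|rs] /=; last by rewrite !andbT.
by rewrite leooxx leq_total.
Qed.
Lemma entry_le_anti e f : entry_le e f -> entry_le f e -> e = f.
Proof.
case: e f => [a r] [b s]; rewrite /entry_le /= => /andP[rs ab] /andP[sr ba].
have E := leoo_anti rs sr; subst s; rewrite eqxx /= in ab ba.
by congr pair; lia.
Qed.
Lemma entry_le_trans e f g : entry_le e f -> entry_le f g -> entry_le e g.
Proof.
case: e f g => [a r] [b s] [c t]; rewrite /entry_le /=.
move=> /andP[rs ab] /andP[st bc]; rewrite (leoo_trans rs st) /=.
apply/implyP=> /eqP E; subst t.
have E := leoo_anti rs st; subst s; rewrite eqxx /= in ab bc.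
exact: leq_trans bc.
Qed.

(** Absent neighbours disappear from the description: the default value -1
    never wins a comparison. *)
Lemma vstepP Q h : h \in domf Q ->
  [\/ [/\ rt h \in domf Q -> (ent Q (rt h)).1 <= (ent Q h).1,
          dn h \in domf Q -> (ent Q (dn h)).1 < (ent Q h).1 &
          vstep (Q, h) = (Q, h)],
      [/\ rt h \in domf Q, (ent Q h).1 < (ent Q (rt h)).1,
          dn h \in domf Q -> (ent Q (dn h)).1.+1 < (ent Q (rt h)).1 &
          vstep (Q, h) = (slide Q h (rt h) (ent Q (rt h)).1.-1, rt h)]
    | [/\ dn h \in domf Q, (ent Q h).1 <= (ent Q (dn h)).1,
          rt h \in domf Q -> (ent Q (rt h)).1 <= (ent Q (dn h)).1.+1 &
          vstep (Q, h) = (slide Q h (dn h) (ent Q (dn h)).1.+1, dn h)]].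
Proof.
case: h => i j hQ; rewrite /vstep /slide /rt /dn /=.
case E : (ent Q (i, j)) => [a r] /=.
have [RQ|RQ] := boolP ((i, j.+1) \in domf Q);
  have [DQ|DQ] := boolP ((i.+1, j) \in domf Q);
  rewrite ?(ent_fnd RQ) ?(ent_fnd DQ) ?(notin_fnd RQ) ?(notin_fnd DQ) /=.
- case: (ent Q (i, j.+1)) => b s; case: (ent Q (i.+1, j)) => c t /=.
  case: ifP => h1; first by constructor 1; split=> // _; lia.
  case: ifP => h2.
    constructor 2; split=> // *; try lia.
    by congr (_.[_ <- (_, _)].[_ <- _], _); lia.
  constructor 3; split=> // *; try lia.
  by congr (_.[_ <- (_, _)].[_ <- _], _); lia.
- case: (ent Q (i, j.+1)) => b s /=.
  case: ifP => h1; first by constructor 1; split=> // _; lia.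
  case: ifP => h2; last by exfalso; lia.
    constructor 2; split=> // *; try lia.
    by congr (_.[_ <- (_, _)].[_ <- _], _); lia.
- case: (ent Q (i.+1, j)) => c t /=.
  case: ifP => h1; first by constructor 1; split=> // _; lia.
  constructor 3; split=> // *; try lia.
  by congr (_.[_ <- (_, _)].[_ <- _], _); lia.
- by constructor 1.
Qed.

(** Absent neighbours disappear from the description: the default mark never
    lies below the active mark. *)
Lemma mstepP P h : h \in domf P ->
  [\/ [/\ lf h \in domf P -> leoo (ent P h).2 (ent P (lf h)).2,
          up h \in domf P -> leoo (ent P h).2 (ent P (up h)).2 &
          mstep (P, h) = (P, h)],
      [/\ up h \in domf P, ltoo (ent P (up h)).2 (ent P h).2,
          lf h \in domf P -> ltoo (ent P (lf h)).2 (ent P h).2 ->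
            (ent P (up h)).1.-1 <= (ent P (lf h)).1 &
          mstep (P, h) = (slide P h (up h) (ent P (up h)).1.-1, up h)]
    | [/\ lf h \in domf P, ltoo (ent P (lf h)).2 (ent P h).2,
          up h \in domf P -> ltoo (ent P (up h)).2 (ent P h).2 ->
            (ent P (lf h)).1.+1 < (ent P (up h)).1 &
          mstep (P, h) = (slide P h (lf h) (ent P (lf h)).1.+1, lf h)]].
Proof.
case: h => i j hP; rewrite /mstep /slide /lf /up /=.
case E : (ent P (i, j)) => [a r] /=.
have rN : leoo r None by case: r {E}.
have [LP|LP] := boolP ((i, j.-1) \in domf P);
  have [UP|UP] := boolP ((i.-1, j) \in domf P);
  rewrite ?(ent_fnd LP) ?(ent_fnd UP) ?(notin_fnd LP) ?(notin_fnd UP) /=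
   /ltoo ?rN ?andbT ?andbF ?orbF /=.
- case: (ent P (i, j.-1)) => b s; case: (ent P (i.-1, j)) => c t /=.
  case: (leoo r s) (leoo r t) => [] [] /=; try by [constructor 1
   | constructor 2 | constructor 3].
  by case: ifP => h2; [constructor 2 | constructor 3]; split=> // *; lia.
- case: (ent P (i, j.-1)) => b s /=.
  by case: (leoo r s); [constructor 1| constructor 3].
- case: (ent P (i.-1, j)) => c t /=.
  by case: (leoo r t); [constructor 1| constructor 2].
- by constructor 1.
Qed.

(** * Content-shifted values and the slide invariant *)

Lemma cell_le_trans : transitive cell_le.
Proof. by move=> d c e; rewrite /cell_le; lia. Qed.

Lemma ssct_rel_trans f (c d e : cell) : cell_le c d -> cell_le d e ->
  ssct_rel f c d -> ssct_rel f d e -> ssct_rel f c e.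
Proof. by rewrite /ssct_rel /cell_le; lia. Qed.

(** The hypothesis on k says that the displaced entry keeps its shifted value.
    *)
Lemma cvalue_slide Q (h y : cell) k (x : cell) : h != y ->
  k + h.1 + y.2 = (ent Q y).1 + y.1 + h.2 ->
  cvalue (slide Q h y k) x = if x == y then ((ent Q h).1%:Z + y.1%:Z - y.2%:Z)%R
    else if x == h then cvalue Q y else cvalue Q x.
Proof.
move=> hy E; rewrite /cvalue ent_slide; case: eqP => [->|_] //.
by case: eqP => [->|_] //=; lia.
Qed.

Section Shape.
Variable sh : {fset cell}.
Hypothesis sh_conv : forall c e d : cell, c \in sh -> d \in sh ->
  cell_le c e -> cell_le e d -> e \in sh.
Variable n : nat.
Hypothesis sh_pos : forall c : cell, c \in sh -> (0 < c.1) && (0 < c.2).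

Definition upset (B : {fset cell}) : Prop :=
  {subset B <= sh} /\
  forall c d : cell, c \in B -> d \in sh -> cell_le c d -> d \in B.

(** The content conditions without those that compare the active cell h with
    cells to its right or below: the value-jdt is there to establish the
    missing ones, and the mark-jdt gives them up. *)
Definition ssct_but (B : {fset cell}) (Q : tableau) (h : cell) : Prop :=
  [/\ domf Q = sh, h \in B,
      forall c d : cell, c \in B -> d \in B -> c != h -> cell_le c d ->
        ssct_rel (cvalue Q) c d
    & forall c : cell, c \in sh -> (cvalue Q c < n%:Z)%R].

Lemma rtP (c d : cell) : c \in sh -> d \in sh -> cell_le c d -> c.2 < d.2 ->
  rt c \in sh /\ cell_le (rt c) d.
Proof.
move=> cs ds cd lt; suff h : cell_le (rt c) d.
  by split=> //; apply: sh_conv cs ds _ h; rewrite /cell_le /=; nat_lia.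
by move: cd; rewrite /cell_le /=; nat_lia.
Qed.

Lemma dnP (c d : cell) : c \in sh -> d \in sh -> cell_le c d -> c.1 < d.1 ->
  dn c \in sh /\ cell_le (dn c) d.
Proof.
move=> cs ds cd lt; suff h : cell_le (dn c) d.
  by split=> //; apply: sh_conv cs ds _ h; rewrite /cell_le /=; nat_lia.
by move: cd; rewrite /cell_le /=; nat_lia.
Qed.

Lemma lfP (c d : cell) : c \in sh -> d \in sh -> cell_le c d -> c.2 < d.2 ->
  lf d \in sh /\ cell_le c (lf d).
Proof.
move=> cs ds cd lt; suff h : cell_le c (lf d).
  by split=> //; apply: sh_conv cs ds h _; rewrite /cell_le /=; nat_lia.
by move: cd; rewrite /cell_le /=; nat_lia.
Qed.

Lemma upP (c d : cell) : c \in sh -> d \in sh -> cell_le c d -> c.1 < d.1 ->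
  up d \in sh /\ cell_le c (up d).
Proof.
move=> cs ds cd lt; suff h : cell_le c (up d).
  by split=> //; apply: sh_conv cs ds h _; rewrite /cell_le /=; nat_lia.
by move: cd; rewrite /cell_le /=; nat_lia.
Qed.

Lemma upset_rt B (h : cell) : upset B -> h \in B -> rt h \in sh -> rt h \in B.
Proof.
by move=> [_ H] hB hs; apply: H hB hs _; rewrite /cell_le /=; nat_lia.
Qed.

Lemma upset_dn B (h : cell) : upset B -> h \in B -> dn h \in sh -> dn h \in B.
Proof.
by move=> [_ H] hB hs; apply: H hB hs _; rewrite /cell_le /=; nat_lia.
Qed.


(** The larger of the two shifted values moves into the hole, so it dominates
    everything to the right and below; and it was at least the active value,
    which therefore stays below all cells that precede its new place. *)
Lemma ssct_but_rt B Q (h : cell) : upset B -> ssct_but B Q h -> rt h \in sh ->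
  (ent Q h).1 < (ent Q (rt h)).1 ->
  (dn h \in sh -> (ent Q (dn h)).1.+1 < (ent Q (rt h)).1) ->
  ssct_but B (slide Q h (rt h) (ent Q (rt h)).1.-1) (rt h).
Proof.
move=> uB [dQ hB G bnd] Rs ab cb; have RB := upset_rt uB hB Rs.
have hs : h \in sh by case: uB => + _; apply.
have hR : h != rt h by apply/eqP=> /(congr1 snd) /=; nat_lia.
have dQ' : domf (slide Q h (rt h) (ent Q (rt h)).1.-1) = sh
  by rewrite domf_move // dQ.
have Wd x := @cvalue_slide Q h (rt h) (ent Q (rt h)).1.-1 x hR.
have {}Wd x : cvalue (slide Q h (rt h) (ent Q (rt h)).1.-1) x =
  if x == rt h then (cvalue Q h - 1)%R else if x == h then cvalue Q (rt h)
    else cvalue Q x.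
  by rewrite Wd /=; [case: eqP => // _; rewrite /cvalue /=; nat_lia | nat_lia].
have hRw : (cvalue Q h <= cvalue Q (rt h))%R by rewrite /cvalue /=; nat_lia.
have DR : dn h \in sh -> (cvalue Q (dn h) <= cvalue Q (rt h))%R.
  by move=> /cb; rewrite /cvalue /=; nat_lia.
have GR e : e \in B -> e != h -> cell_le e (rt h) ->
  ssct_rel (cvalue Q) e (rt h).
  by move=> eB eh eR; apply: G.
split=> //; last first.
  move=> c cs; rewrite Wd; case: eqP => [_|_]; first by have := bnd _ hs;
    nat_lia.
  by case: eqP => [_|_]; [exact: bnd _ Rs | exact: bnd].
move=> c d cB dB cR cd; have cs : c \in sh by case: uB => + _; apply.
have ds : d \in sh by case: uB => + _; apply.
rewrite /ssct_rel !Wd (negPf cR).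
have [dR|dR] := eqVneq d (rt h).
  subst d; have [ch|ch] := eqVneq c h.
    by split=> //; nat_lia.
  by have := GR _ cB ch cd; rewrite /ssct_rel; nat_lia.
have [dh|dh] := eqVneq d h.
  subst d; have [ch|ch] := eqVneq c h; first by subst c; split=> //; nat_lia.
  have cR' : cell_le c (rt h) by move: cd; rewrite /cell_le /=; nat_lia.
  by have := GR _ cB ch cR'; rewrite /ssct_rel /=; nat_lia.
have [ch|ch] := eqVneq c h; last by apply: G.
subst c; have [rd|rd] := boolP (cell_le (rt h) d).
  have := G _ _ RB dB _ rd; rewrite eq_sym => /(_ hR); rewrite /ssct_rel /=.
  move=> [g1 g2]; split=> // lt.
  have [|e] := ltnP h.2.+1 d.2; first by nat_lia.
  (* strictness is only missing when d lies below rt h in the same column;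
     the slide went right because dn h is not larger than rt h, and d lies
     strictly to the right of dn h *)
  have [|Ds Dd] := dnP hs ds cd.
    by move: rd dR => + /cell_neq; rewrite /cell_le /=; nat_lia.
  have := G _ _ (upset_dn uB hB Ds) dB _ Dd; rewrite /ssct_rel /=.
  have -> : dn h != h by apply/eqP=> /(congr1 fst) /=; nat_lia.
  by move: (DR Ds) => ? /(_ isT); nat_lia.
have [|Ds Dd] := dnP hs ds cd.
  by move: rd cd dh => + + /cell_neq; rewrite /cell_le /=; nat_lia.
have := G _ _ (upset_dn uB hB Ds) dB _ Dd; rewrite /ssct_rel /=.
have -> : dn h != h by apply/eqP=> /(congr1 fst) /=; nat_lia.
by move: (DR Ds) => ? /(_ isT); move: rd cd; rewrite /cell_le /=; nat_lia.
Qed.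

Lemma ssct_but_dn B Q (h : cell) : upset B -> ssct_but B Q h -> dn h \in sh ->
  (ent Q h).1 <= (ent Q (dn h)).1 ->
  (rt h \in sh -> (ent Q (rt h)).1 <= (ent Q (dn h)).1.+1) ->
  ssct_but B (slide Q h (dn h) (ent Q (dn h)).1.+1) (dn h).
Proof.
move=> uB [dQ hB G bnd] Ds ac bc; have DB := upset_dn uB hB Ds.
have hs : h \in sh by case: uB => + _; apply.
have hD : h != dn h by apply/eqP=> /(congr1 fst) /=; nat_lia.
have dQ' : domf (slide Q h (dn h) (ent Q (dn h)).1.+1) = sh
  by rewrite domf_move // dQ.
have Wd x : cvalue (slide Q h (dn h) (ent Q (dn h)).1.+1) x =
  if x == dn h then (cvalue Q h + 1)%R else if x == h then cvalue Q (dn h)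
    else cvalue Q x.
  by rewrite cvalue_slide //=; [case: eqP => // _; rewrite /cvalue /=;
    nat_lia | nat_lia].
have hDw : (cvalue Q h < cvalue Q (dn h))%R by rewrite /cvalue /=; nat_lia.
have RD : rt h \in sh -> (cvalue Q (rt h) < cvalue Q (dn h))%R.
  by move=> /bc; rewrite /cvalue /=; nat_lia.
have GD e : e \in B -> e != h -> cell_le e (dn h) ->
  ssct_rel (cvalue Q) e (dn h).
  by move=> eB eh eD; apply: G.
split=> //; last first.
  move=> c cs; rewrite Wd; case: eqP => [_|_]; first by have := bnd _ Ds;
    nat_lia.
  by case: eqP => [_|_]; [exact: bnd _ Ds | exact: bnd].
move=> c d cB dB cD cd; have cs : c \in sh by case: uB => + _; apply.
have ds : d \in sh by case: uB => + _; apply.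
rewrite /ssct_rel !Wd (negPf cD).
have [dD|dD] := eqVneq d (dn h).
  subst d; have [ch|ch] := eqVneq c h; first by subst c; split=> //=; nat_lia.
  by have := GD _ cB ch cd; rewrite /ssct_rel; nat_lia.
have [dh|dh] := eqVneq d h.
  subst d; have [ch|ch] := eqVneq c h; first by subst c; split=> //; nat_lia.
  have cD' : cell_le c (dn h) by move: cd; rewrite /cell_le /=; nat_lia.
  by have := GD _ cB ch cD'; rewrite /ssct_rel /=; nat_lia.
have [ch|ch] := eqVneq c h; last by apply: G.
subst c; have [dd|dd] := boolP (cell_le (dn h) d).
  by have := G _ _ DB dB _ dd; rewrite eq_sym => /(_ hD).
have [|Rs Rd] := rtP hs ds cd.
  by move: dd cd dh => + + /cell_neq; rewrite /cell_le /=; nat_lia.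
have := G _ _ (upset_rt uB hB Rs) dB _ Rd; rewrite /ssct_rel /=.
have -> : rt h != h by apply/eqP=> /(congr1 snd) /=; nat_lia.
by move: (RD Rs) => ? /(_ isT); nat_lia.
Qed.

(** The mirror image of the forward slides: the smaller of the two shifted
    values moves into the hole, so everything above and to the left dominates
    it. *)
Lemma ssct_but_lf B P (h : cell) : upset B -> ssct_but B P h -> lf h \in B ->
  (up h \in B -> (ent P (lf h)).1.+1 < (ent P (up h)).1) ->
  ssct_but B (slide P h (lf h) (ent P (lf h)).1.+1) (lf h).
Proof.
move=> uB [dQ hB G bnd] LB cb.
have hs : h \in sh by case: uB => + _; apply.
have Ls : lf h \in sh by case: uB => + _; apply.
have := sh_pos hs; have := sh_pos Ls => /= L0 h0.
have hL : h != lf h by apply/eqP=> /(congr1 snd) /=; nat_lia.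
have dQ' : domf (slide P h (lf h) (ent P (lf h)).1.+1) = sh
  by rewrite domf_move // dQ.
have Wd x : cvalue (slide P h (lf h) (ent P (lf h)).1.+1) x =
  if x == lf h then (cvalue P h + 1)%R else if x == h then cvalue P (lf h)
    else cvalue P x.
  by rewrite cvalue_slide //=; [case: eqP => // _; rewrite /cvalue /=;
    nat_lia | nat_lia].
have Lh : cell_le (lf h) h by rewrite /cell_le /=; nat_lia.
have hLw : (cvalue P h < cvalue P (lf h))%R.
  by have := G _ _ LB hB _ Lh; rewrite eq_sym => /(_ hL);
    rewrite /ssct_rel /=; nat_lia.
have LU : up h \in B -> (cvalue P (lf h) <= cvalue P (up h))%R.
  by move=> /cb; rewrite /cvalue /=; nat_lia.
have GL e : e \in B -> e != h -> cell_le e (lf h) ->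
  ssct_rel (cvalue P) e (lf h).
  by move=> eB eh eL; apply: G.
split=> //; last first.
  move=> c cs; rewrite Wd; case: eqP => [_|_]; first by have := bnd _ Ls;
    nat_lia.
  by case: eqP => [_|_]; [exact: bnd _ Ls | exact: bnd].
move=> c d cB dB cL cd; have cs : c \in sh by case: uB => + _; apply.
have ds : d \in sh by case: uB => + _; apply.
rewrite /ssct_rel !Wd (negPf cL).
have [dL|dL] := eqVneq d (lf h).
  subst d; have ch : c != h.
    by apply: contraTneq cd => ->; rewrite /cell_le /=; nat_lia.
  rewrite (negPf ch).
  have := GL _ cB ch cd; have hL2 := hLw.
  have cLr : cell_le c h by move: cd; rewrite /cell_le /=; nat_lia.
  have := G _ _ cB hB ch cLr; rewrite /ssct_rel /=.
  by move: cd; rewrite /cell_le /=; nat_lia.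
have [dh|dh] := eqVneq d h.
  subst d; have [ch|ch] := eqVneq c h; first by subst c; split=> //; nat_lia.
  have [cl|cl] := boolP (cell_le c (lf h)).
    have := GL _ cB ch cl; rewrite /ssct_rel /= => -[g1 g2]; split=> // lt.
    have [|e] := ltnP c.2 h.2.-1; first by nat_lia.
    have [|Us cU] := upP cs hs cd.
      by move: cl cL => + /cell_neq; rewrite /cell_le /=; nat_lia.
    have UB : up h \in B by case: uB => _; apply; [exact: cB| |].
    have Uh : c != h by [].
    have := G _ _ cB UB ch cU; rewrite /ssct_rel /=.
    by have := LU UB; nat_lia.
  have [|Us cU] := upP cs hs cd.
    by move: cl cd ch => + + /cell_neq; rewrite /cell_le /=; nat_lia.
  have UB : up h \in B by case: uB => _; apply; [exact: cB| |].
  have := G _ _ cB UB ch cU; rewrite /ssct_rel /=.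
  by have := LU UB; nat_lia.
have [ch|ch] := eqVneq c h; last by apply: G.
subst c; have ld : cell_le (lf h) d by move: cd; rewrite /cell_le /=; nat_lia.
have := G _ _ LB dB _ ld; rewrite eq_sym => /(_ hL); rewrite /ssct_rel /=.
by move: cd; rewrite /cell_le; nat_lia.
Qed.

Lemma ssct_but_up B P (h : cell) : upset B -> ssct_but B P h -> up h \in B ->
  (lf h \in B -> (ent P (up h)).1.-1 <= (ent P (lf h)).1) ->
  ssct_but B (slide P h (up h) (ent P (up h)).1.-1) (up h).
Proof.
move=> uB [dQ hB G bnd] UB cb.
have hs : h \in sh by case: uB => + _; apply.
have Us : up h \in sh by case: uB => + _; apply.
have := sh_pos hs; have := sh_pos Us => /= U0 h0.
have hU : h != up h by apply/eqP=> /(congr1 fst) /=; nat_lia.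
have dQ' : domf (slide P h (up h) (ent P (up h)).1.-1) = sh
  by rewrite domf_move // dQ.
have Uh : cell_le (up h) h by rewrite /cell_le /=; nat_lia.
have hUw : (cvalue P h <= cvalue P (up h))%R.
  by have := G _ _ UB hB _ Uh; rewrite eq_sym => /(_ hU);
    rewrite /ssct_rel /=; nat_lia.
have U1 : 0 < (ent P (up h)).1 by move: hUw; rewrite /cvalue /=; nat_lia.
have Wd x : cvalue (slide P h (up h) (ent P (up h)).1.-1) x =
  if x == up h then (cvalue P h - 1)%R else if x == h then cvalue P (up h)
    else cvalue P x.
  by rewrite cvalue_slide //=; [case: eqP => // _; rewrite /cvalue /=;
    nat_lia | nat_lia].
have UL : lf h \in B -> (cvalue P (up h) < cvalue P (lf h))%R.
  by move=> /cb; rewrite /cvalue /=; nat_lia.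
have GU e : e \in B -> e != h -> cell_le e (up h) ->
  ssct_rel (cvalue P) e (up h).
  by move=> eB eh eU; apply: G.
split=> //; last first.
  move=> c cs; rewrite Wd; case: eqP => [_|_]; first by have := bnd _ hs;
    nat_lia.
  by case: eqP => [_|_]; [exact: bnd _ Us | exact: bnd].
move=> c d cB dB cU cd; have cs : c \in sh by case: uB => + _; apply.
have ds : d \in sh by case: uB => + _; apply.
rewrite /ssct_rel !Wd (negPf cU).
have [dU|dU] := eqVneq d (up h).
  subst d; have ch : c != h.
    by apply: contraTneq cd => ->; rewrite /cell_le /=; nat_lia.
  rewrite (negPf ch).
  have cLr : cell_le c h by move: cd; rewrite /cell_le /=; nat_lia.
  by have := G _ _ cB hB ch cLr; rewrite /ssct_rel /=; nat_lia.
have [dh|dh] := eqVneq d h.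
  subst d; have [ch|ch] := eqVneq c h; first by subst c; split=> //; nat_lia.
  have [cl|cl] := boolP (cell_le c (up h)).
    by have := GU _ cB ch cl; rewrite /ssct_rel /=.
  have [|Ls cL] := lfP cs hs cd.
    by move: cl cd ch => + + /cell_neq; rewrite /cell_le /=; nat_lia.
  have LB : lf h \in B by case: uB => _; apply; [exact: cB| |].
  have := G _ _ cB LB ch cL; rewrite /ssct_rel /=.
  by have := UL LB; nat_lia.
have [ch|ch] := eqVneq c h; last by apply: G.
subst c; have ud : cell_le (up h) d by move: cd; rewrite /cell_le /=; nat_lia.
have := G _ _ UB dB _ ud; rewrite eq_sym => /(_ hU); rewrite /ssct_rel /=.
by move: cd; rewrite /cell_le; nat_lia.
Qed.

(** The test that ends the value-jdt compares the active cell with exactly the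
    two neighbours through which all omitted comparisons factor. *)
Lemma ssct_but_stop B Q (h : cell) : upset B -> ssct_but B Q h ->
  (rt h \in sh -> (ent Q (rt h)).1 <= (ent Q h).1) ->
  (dn h \in sh -> (ent Q (dn h)).1 < (ent Q h).1) ->
  forall c d : cell, c \in B -> d \in B -> cell_le c d ->
    ssct_rel (cvalue Q) c d.
Proof.
move=> uB [dQ hB G bnd] Ra Da c d cB dB cd.
have [ch|ch] := eqVneq c h; last exact: G.
subst c; have hs : h \in sh by case: uB => + _; apply.
have ds : d \in sh by case: uB => + _; apply.
have [lt|ge] := ltnP h.2 d.2.
  have [Rs Rd] := rtP hs ds cd lt.
  have := G _ _ (upset_rt uB hB Rs) dB _ Rd.
  have -> : rt h != h by apply/eqP=> /(congr1 snd) /=; nat_lia.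
  by move: (Ra Rs); rewrite /ssct_rel /cvalue /= => ? /(_ isT); nat_lia.
have [->|dh] := eqVneq d h; first by split=> //; nat_lia.
have [|Ds Dd] := dnP hs ds cd.
  by move: dh cd => /cell_neq; rewrite /cell_le; nat_lia.
have := G _ _ (upset_dn uB hB Ds) dB _ Dd.
have -> : dn h != h by apply/eqP=> /(congr1 fst) /=; nat_lia.
by move: (Da Ds); rewrite /ssct_rel /cvalue /= => ? /(_ isT); nat_lia.
Qed.

End Shape.

(** * Runs of the two loops *)

Section Runs.
Variables (sh : {fset cell}) (n : nat).
Hypothesis sh_conv : forall c e d : cell, c \in sh -> d \in sh ->
  cell_le c e -> cell_le e d -> e \in sh.
Hypothesis sh_pos : forall c : cell, c \in sh -> (0 < c.1) && (0 < c.2).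

(** A cell off the rectangle between the start u and the active cell still has
    its original entry, so every decision of the value-jdt can be read off the
    original tableau T. *)
Definition vrun (B : {fset cell}) (T : tableau) (u : cell)
    (x : tableau * cell) : Prop :=
  [/\ ssct_but sh n B x.1 x.2, cell_le u x.2, ent x.1 x.2 = ent T u &
      forall c : cell, ~~ (cell_le u c && cell_le c x.2) ->
        ent x.1 c = ent T c].

(** Here too the decisions can be read off the original tableau. *)
Definition mrun (B : {fset cell}) (T : tableau) (v : cell)
    (x : tableau * cell) : Prop :=
  [/\ ssct_but sh n B x.1 x.2, cell_le x.2 v, ent x.1 x.2 = ent T v &
      forall c : cell, ~~ (cell_le x.2 c && cell_le c v) ->
        ent x.1 c = ent T c].

Definition ishead (T : tableau) (B : {fset cell}) (v : cell) : Prop :=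
  v \in B /\ forall c : cell, c \in B -> entry_le (ent T c) (ent T v) /\
    (ent T c = ent T v -> v.2 <= c.2).

Definition istail (T : tableau) (A : {fset cell}) (u : cell) : Prop :=
  u \in A /\ forall c : cell, c \in A -> entry_le (ent T u) (ent T c) /\
    (ent T c = ent T u -> c.2 <= u.2).

Lemma vrun_step B T u x : upset sh B -> vrun B T u x ->
  [\/ [/\ vstep x = x,
          rt x.2 \in sh -> (ent T (rt x.2)).1 <= (ent T u).1 &
          dn x.2 \in sh -> (ent T (dn x.2)).1 < (ent T u).1],
      [/\ vstep x = (slide x.1 x.2 (rt x.2) (ent T (rt x.2)).1.-1, rt x.2),
          rt x.2 \in sh, (ent T u).1 < (ent T (rt x.2)).1,
          dn x.2 \in sh -> (ent T (dn x.2)).1.+1 < (ent T (rt x.2)).1 &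
          vrun B T u (vstep x)]
    | [/\ vstep x = (slide x.1 x.2 (dn x.2) (ent T (dn x.2)).1.+1, dn x.2),
          dn x.2 \in sh, (ent T u).1 <= (ent T (dn x.2)).1,
          rt x.2 \in sh -> (ent T (rt x.2)).1 <= (ent T (dn x.2)).1.+1 &
          vrun B T u (vstep x)]].
Proof.
case: x => Q h uB [J uh aE same]; rewrite /= in J uh aE same *.
have eR : ent Q (rt h) = ent T (rt h).
  by apply: same; rewrite /cell_le /=; nat_lia.
have eD : ent Q (dn h) = ent T (dn h).
  by apply: same; rewrite /cell_le /=; nat_lia.
have [dQ hB _ _] := J; have hs : h \in sh by case: uB => + _; apply.
have hdQ : h \in domf Q by rewrite dQ.
have [[]|[]|[]] := vstepP hdQ; rewrite dQ aE eR eD.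
- by move=> h1 h2 E; constructor 1.
- move=> ys h1 h2 E; constructor 2; split=> //; rewrite E; split => //=.
  + by rewrite -eR; apply: ssct_but_rt; rewrite ?aE ?eR ?eD.
  + by move: uh; rewrite /cell_le /=; nat_lia.
  + by rewrite ent_slide eqxx.
  + move=> c nc; rewrite ent_slide; case: eqP => [E1|_].
      by move: nc uh; rewrite E1 /cell_le /=; nat_lia.
    case: eqP => [E1|_]; first by move: nc uh; rewrite E1 /cell_le /=; nat_lia.
    by apply: same; move: nc; rewrite /cell_le /=; nat_lia.
- move=> ys h1 h2 E; constructor 3; split=> //; rewrite E; split => //=.
  + by rewrite -eD; apply: ssct_but_dn; rewrite ?aE ?eR ?eD.
  + by move: uh; rewrite /cell_le /=; nat_lia.
  + by rewrite ent_slide eqxx.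
  + move=> c nc; rewrite ent_slide; case: eqP => [E1|_].
      by move: nc uh; rewrite E1 /cell_le /=; nat_lia.
    case: eqP => [E1|_]; first by move: nc uh; rewrite E1 /cell_le /=; nat_lia.
    by apply: same; move: nc; rewrite /cell_le /=; nat_lia.
Qed.

Lemma vrun_iter B T u k : upset sh B -> ssct_but sh n B T u ->
  vrun B T u (iter k vstep (T, u)).
Proof.
move=> uB J; elim: k => [|k IH]; last first.
  by rewrite iterS; have [[->]|[]|[]] := vrun_step uB IH.
by split=> //=; rewrite /cell_le !leqnn.
Qed.

Lemma vrun_out B T u x (c : cell) : upset sh B -> ssct_but sh n B T u ->
  vrun B T u x ->
  c \in sh -> c \notin B -> ent x.1 c = ent T c.
Proof.
move=> [_ uB] [_ uuB _ _] [_ _ _ same] cs /negP cB.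
apply: same; apply/negP=> /andP[uc _]; apply: cB; exact: uB uuB cs uc.
Qed.

(** After a move to the right, the cell above the new active one has at least
    the shifted value of the displaced entry, so the backward slide returns to
    the left; after a move down, the left neighbour has a larger shifted value
    and the slide returns upwards. Cells outside B have marks too large to be
    chosen at all. *)
Lemma vstep_undone B T u x : upset sh B -> ssct_but sh n B T u ->
  vrun B T u x ->
  (forall c : cell, c \in sh -> c \notin B -> leoo (ent T u).2 (ent T c).2) ->
  ((vstep x).2 != x.2 -> ltoo (ent T (vstep x).2).2 (ent T u).2) ->
  vstep x = x \/ mstep (vstep x) = x.
Proof.
move=> uB J0 fx out pass; have [[]|[]|[]] := vrun_step uB fx; first by left.
all: have fout := vrun_out uB J0 fx.
all: case: x fx pass fout => Q h [/= J uh aE same] pass fout E ys h1 h2 fy;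
  right.
- have hR : h != rt h by apply/eqP=> /(congr1 snd) /=; nat_lia.
  have [dQ hB G bnd] := J; have hs : h \in sh by case: uB => + _; apply.
  move: pass; rewrite E /= eq_sym => /(_ hR) st.
  have yB : rt h \in B by exact: upset_rt uB hB ys.
  have eR : ent Q (rt h) = ent T (rt h).
    by apply: same; rewrite /cell_le /=; nat_lia.
  set Q' := slide _ _ _ _.
  have dQ' : domf Q' = sh by rewrite domf_move dQ.
  have ydQ : rt h \in domf Q' by rewrite dQ'.
  have lfy : lf (rt h) = h by case: (h).
  have eh : ent Q' h = ((ent T (rt h)).1.-1, (ent T (rt h)).2).
    by rewrite ent_slide (negPf hR) eqxx eR.
  have ey : ent Q' (rt h) = ent T u by rewrite ent_slide eqxx.
  have [[]|[]|[]] := mstepP ydQ; rewrite lfy dQ' eh ey /=.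
  + by move=> /(_ hs) lerS; move: st; rewrite /ltoo lerS.
  + move=> us; have := sh_pos us; move: us; set w := up _ => us upos.
    have wR : w != rt h.
      by apply/eqP=> /(congr1 fst); move: upos; rewrite /w /=; nat_lia.
    have wh : w != h.
      by apply/eqP=> /(congr1 snd); rewrite /w /=; nat_lia.
    have ew : ent Q' w = ent Q w by rewrite ent_slide (negPf wR) (negPf wh).
    rewrite ew => tr /(_ hs st) cb _; exfalso.
    have wB : w \in B.
      apply/negPn/negP=> wB; move: tr; rewrite fout //.
      by rewrite /ltoo out.
    have wle : cell_le w (rt h) by rewrite /cell_le /w /=; nat_lia.
    have := G _ _ wB yB wh wle; rewrite /ssct_rel /cvalue eR /w /=.
    by move: cb h1 upos; rewrite /w /=; nat_lia.
  + move=> _ _ _ ->; congr (_, _).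
    have -> : (ent T (rt h)).1.-1.+1 = (ent Q (rt h)).1 by rewrite eR; nat_lia.
    by apply: slideK; rewrite ?dQ.
- have hR : h != dn h by apply/eqP=> /(congr1 fst) /=; nat_lia.
  have [dQ hB G bnd] := J; have hs : h \in sh by case: uB => + _; apply.
  move: pass; rewrite E /= eq_sym => /(_ hR) st.
  have yB : dn h \in B by exact: upset_dn uB hB ys.
  have eD : ent Q (dn h) = ent T (dn h).
    by apply: same; rewrite /cell_le /=; nat_lia.
  set Q' := slide _ _ _ _.
  have dQ' : domf Q' = sh by rewrite domf_move dQ.
  have ydQ : dn h \in domf Q' by rewrite dQ'.
  have upy : up (dn h) = h by case: (h).
  have eh : ent Q' h = ((ent T (dn h)).1.+1, (ent T (dn h)).2).
    by rewrite ent_slide (negPf hR) eqxx eD.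
  have ey : ent Q' (dn h) = ent T u by rewrite ent_slide eqxx.
  have [[]|[]|[]] := mstepP ydQ; rewrite upy dQ' eh ey /=.
  + by move=> _ /(_ hs) lerS; move: st; rewrite /ltoo lerS.
  + move=> _ _ _ ->; congr (_, _).
    by rewrite -eD; apply: slideK; rewrite ?dQ.
  + move=> us; have := sh_pos us; move: us; set w := lf _ => us upos.
    have wR : w != dn h.
      by apply/eqP=> /(congr1 snd); move: upos; rewrite /w /=; nat_lia.
    have wh : w != h.
      by apply/eqP=> /(congr1 fst); rewrite /w /=; nat_lia.
    have ew : ent Q' w = ent Q w by rewrite ent_slide (negPf wR) (negPf wh).
    rewrite ew => tr /(_ hs st) cb _; exfalso.
    have wB : w \in B.
      apply/negPn/negP=> wB; move: tr; rewrite fout //.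
      by rewrite /ltoo out.
    have wle : cell_le w (dn h) by rewrite /cell_le /w /=; nat_lia.
    have := G _ _ wB yB wh wle; rewrite /ssct_rel /cvalue eD /w /=.
    by move: cb h1 upos; rewrite /w /=; nat_lia.
Qed.

(** The bound on the columns turns the comparison of shifted values into one of
    values: the entry has at least the active value. If its mark were the
    largest one, it would be an equal entry to the left of the head. *)
Lemma mrun_passed B T v x (c : cell) : upset sh B -> ishead T B v ->
  mrun B T v x ->
  c \in B -> cell_le c x.2 -> (c.1 < x.2.1) || (c.2 < x.2.2) ->
  x.2.2 <= c.2.+1 -> ltoo (ent T c).2 (ent T v).2.
Proof.
move=> uB [vB hd] [[dQ hB G bnd] hv aE same] cB ch lt adj.
have cx : c != x.2 by apply: contraTneq lt => ->; rewrite !ltnn.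
have eC : ent x.1 c = ent T c.
  by apply: same; move: lt ch; rewrite /cell_le /=; nat_lia.
have [le lfm] := hd _ cB; have := G _ _ cB hB cx ch.
rewrite /ssct_rel /cvalue eC aE => -[g1 g2]; rewrite /ltoo; apply/negP=> rs.
have Es : (ent T c).2 = (ent T v).2 by apply: leoo_anti => //; case/andP: le.
have ba : (ent T c).1 <= (ent T v).1.
  by move: le; rewrite /entry_le Es eqxx => /andP[_].
have ba' : (ent T c).1 = (ent T v).1.
  by move: g1 g2 ch; rewrite /cell_le; nat_lia.
have := lfm; rewrite [ent T c]surjective_pairing [ent T v]surjective_pairing.
rewrite Es ba' => /(_ erefl) vc; move: ch hv lt g1 g2; rewrite /cell_le.
by nat_lia.
Qed.

Lemma mrun_step B T v x : upset sh B -> ishead T B v ->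
  (forall c : cell, c \in sh -> c \notin B -> leoo (ent T v).2 (ent T c).2) ->
  mrun B T v x ->
  [\/ [/\ mstep x = x, lf x.2 \notin B & up x.2 \notin B],
      [/\ mstep x = (slide x.1 x.2 (up x.2) (ent T (up x.2)).1.-1, up x.2),
          up x.2 \in B, (ent T v).1 < (ent T (up x.2)).1,
          lf x.2 \in B -> (ent T (up x.2)).1 <= (ent T (lf x.2)).1.+1 &
          mrun B T v (mstep x)]
    | [/\ mstep x = (slide x.1 x.2 (lf x.2) (ent T (lf x.2)).1.+1, lf x.2),
          lf x.2 \in B, (ent T v).1 <= (ent T (lf x.2)).1,
          up x.2 \in B -> (ent T (lf x.2)).1.+1 < (ent T (up x.2)).1 &
          mrun B T v (mstep x)]].
Proof.
case: x => Q h uB hd out bx; have bp c := mrun_passed (c := c) uB hd bx.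
move: (bx) => [J hv aE same]; rewrite /= in J hv aE same bp *.
have [dQ hB G bnd] := J; have hs : h \in sh by case: uB => + _; apply.
have hdQ : h \in domf Q by rewrite dQ.
have hpos := sh_pos hs.
have eL : ent Q (lf h) = ent T (lf h).
  by apply: same; move: hpos; rewrite /cell_le /=; nat_lia.
have eU : ent Q (up h) = ent T (up h).
  by apply: same; move: hpos; rewrite /cell_le /=; nat_lia.
have Lle : cell_le (lf h) h by rewrite /cell_le /=; nat_lia.
have Ule : cell_le (up h) h by rewrite /cell_le /=; nat_lia.
have Lh : lf h != h by apply/eqP=> /(congr1 snd); move: hpos => /=; nat_lia.
have Uh : up h != h by apply/eqP=> /(congr1 fst); move: hpos => /=; nat_lia.
have Bs (c : cell) : c \in B -> c \in sh by case: uB => + _; apply.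
have Lm : lf h \in B -> ltoo (ent T (lf h)).2 (ent T v).2.
  by move=> LB; apply: bp => //=; move: hpos => /=; nat_lia.
have Um : up h \in B -> ltoo (ent T (up h)).2 (ent T v).2.
  by move=> UB; apply: bp => //=; move: hpos => /=; nat_lia.
have in_sorted (c : cell) : c \in sh -> ltoo (ent T c).2 (ent T v).2 -> c \in B.
  by move=> cs; apply: contraLR => /(out _ cs); rewrite /ltoo => ->.
have [[]|[]|[]] := mstepP hdQ; rewrite dQ aE eL eU.
- move=> h1 h2 E; constructor 1; split=> //; apply/negP=> cB.
    by have := Lm cB; rewrite /ltoo h1 // Bs.
  by have := Um cB; rewrite /ltoo h2 // Bs.
- move=> h1 h2 h3 E; have UB := in_sorted _ h1 h2.
  have c1 : (ent T v).1 < (ent T (up h)).1.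
    have := G _ _ UB hB Uh Ule; rewrite /ssct_rel /cvalue /= aE eU.
    by move: hpos; nat_lia.
  have h3' : lf h \in B -> (ent T (up h)).1 <= (ent T (lf h)).1.+1.
    by move=> LB; have := h3 (Bs _ LB) (Lm LB); nat_lia.
  constructor 2; split=> //; rewrite E; split=> //=.
  + rewrite -eU; apply: ssct_but_up; rewrite ?aE ?eL ?eU //.
    by move=> LB; apply: h3; rewrite ?Lm ?Bs.
  + by move: hv; rewrite /cell_le /=; nat_lia.
  + by rewrite ent_slide eqxx.
  + move=> c nc; rewrite ent_slide; case: eqP => [E1|_].
      by move: nc hv; rewrite E1 /cell_le /=; nat_lia.
    case: eqP => [E1|_]; first by move: nc hv; rewrite E1 /cell_le /=; nat_lia.
    by apply: same; move: nc; rewrite /cell_le /=; nat_lia.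
- move=> h1 h2 h3 E; have LB := in_sorted _ h1 h2.
  have c1 : (ent T v).1 <= (ent T (lf h)).1.
    have := G _ _ LB hB Lh Lle; rewrite /ssct_rel /cvalue /= aE eL.
    by move: hpos; nat_lia.
  have h3' : up h \in B -> (ent T (lf h)).1.+1 < (ent T (up h)).1.
    by move=> UB; apply: h3; rewrite ?Um ?Bs.
  constructor 3; split=> //; rewrite E; split=> //=.
  + by rewrite -eL; apply: ssct_but_lf; rewrite ?aE ?eL ?eU //.
  + by move: hv; rewrite /cell_le /=; nat_lia.
  + by rewrite ent_slide eqxx.
  + move=> c nc; rewrite ent_slide; case: eqP => [E1|_].
      by move: nc hv; rewrite E1 /cell_le /=; nat_lia.
    case: eqP => [E1|_]; first by move: nc hv; rewrite E1 /cell_le /=; nat_lia.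
    by apply: same; move: nc; rewrite /cell_le /=; nat_lia.
Qed.

Lemma mrun_iter B T v k : upset sh B -> ishead T B v ->
  (forall c : cell, c \in sh -> c \notin B -> leoo (ent T v).2 (ent T c).2) ->
  ssct_but sh n B T v -> mrun B T v (iter k mstep (T, v)).
Proof.
move=> uB hd out J; elim: k => [|k IH]; last first.
  by rewrite iterS; have [[->]|[]|[]] := mrun_step uB hd out IH.
by split=> //=; rewrite /cell_le !leqnn.
Qed.

(** After a backward slide to the left, the displaced entry exceeds the active
    value and has at least the shifted value of the cell below the new active
    one, so it is taken back; the upward case is similar. *)
Lemma mstep_undone B T v x : upset sh B -> ishead T B v ->
  (forall c : cell, c \in sh -> c \notin B -> leoo (ent T v).2 (ent T c).2) ->
  mrun B T v x -> mstep x = x \/ vstep (mstep x) = x.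
Proof.
move=> uB hd out bx; have [[]|[]|[]] := mrun_step uB hd out bx; first by left.
all: case: x bx => Q h [/= J hv aE same] E yB h1 h2 by'; right.
all: have [dQ hB G bnd] := J; have hs : h \in sh by case: uB => + _; apply.
all: have hpos := sh_pos hs.
all: have Bs (c : cell) : c \in B -> c \in sh by case: uB => + _; apply.
all: rewrite E; set Q' := slide _ _ _ _.
all: have dQ' : domf Q' = sh by rewrite domf_move ?dQ ?Bs.
- have hU : h != up h by apply/eqP=> /(congr1 fst); move: hpos => /=; nat_lia.
  have eU : ent Q (up h) = ent T (up h).
    by apply: same; move: hpos; rewrite /cell_le /=; nat_lia.
  have ydQ : up h \in domf Q' by rewrite dQ' Bs.
  have dny : dn (up h) = h by case: (h) hpos => [[|i] j].
  have eh : ent Q' h = ((ent T (up h)).1.-1, (ent T (up h)).2).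
    by rewrite ent_slide (negPf hU) eqxx eU.
  have ey : ent Q' (up h) = ent T v by rewrite ent_slide eqxx.
  have [[]|[]|[]] := vstepP ydQ; rewrite dny dQ' eh ey /=.
  + by move=> _ /(_ hs); move: h1; nat_lia.
  + set w := rt _ => ws; have wB : w \in B.
      by case: uB => _; apply; [exact: yB|exact: ws|rewrite /cell_le /=;
        nat_lia].
    have wU : w != up h by apply/eqP=> /(congr1 snd); rewrite /w /=; nat_lia.
    have wh : w != h.
      by apply/eqP=> /(congr1 fst); move: hpos; rewrite /w /=; nat_lia.
    have ew : ent Q' w = ent Q w by rewrite ent_slide (negPf wU) (negPf wh).
    rewrite ew => _ /(_ hs) cb _; exfalso.
    have wle : cell_le (up h) w by rewrite /cell_le /w /=; nat_lia.
    have := G _ _ yB wB _ wle; rewrite eq_sym => /(_ hU).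
    by rewrite /ssct_rel /cvalue eU /w /=; move: cb h1; rewrite /w; nat_lia.
  + move=> _ _ _ ->; congr (_, _).
    have -> : (ent T (up h)).1.-1.+1 = (ent Q (up h)).1 by rewrite eU; nat_lia.
    by apply: slideK; rewrite ?dQ // Bs.
- have hL : h != lf h by apply/eqP=> /(congr1 snd); move: hpos => /=; nat_lia.
  have eL : ent Q (lf h) = ent T (lf h).
    by apply: same; move: hpos; rewrite /cell_le /=; nat_lia.
  have ydQ : lf h \in domf Q' by rewrite dQ' Bs.
  have rty : rt (lf h) = h by case: (h) hpos => [i [|j]] //=; rewrite andbF.
  have eh : ent Q' h = ((ent T (lf h)).1.+1, (ent T (lf h)).2).
    by rewrite ent_slide (negPf hL) eqxx eL.
  have ey : ent Q' (lf h) = ent T v by rewrite ent_slide eqxx.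
  have [[]|[]|[]] := vstepP ydQ; rewrite rty dQ' eh ey /=.
  + by move=> /(_ hs); move: h1; nat_lia.
  + move=> _ _ _ ->; congr (_, _).
    by rewrite -eL; apply: slideK; rewrite ?dQ // Bs.
  + set w := dn _ => ws; have wB : w \in B.
      by case: uB => _; apply; [exact: yB|exact: ws|rewrite /cell_le /=;
        nat_lia].
    have wL : w != lf h by apply/eqP=> /(congr1 fst); rewrite /w /=; nat_lia.
    have wh : w != h.
      by apply/eqP=> /(congr1 snd); move: hpos; rewrite /w /=; nat_lia.
    have ew : ent Q' w = ent Q w by rewrite ent_slide (negPf wL) (negPf wh).
    rewrite ew => _ /(_ hs) cb _; exfalso.
    have wle : cell_le (lf h) w by rewrite /cell_le /w /=; nat_lia.
    have := G _ _ yB wB _ wle; rewrite eq_sym => /(_ hL).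
    by rewrite /ssct_rel /cvalue eL /w /=; move: cb h1; rewrite /w; nat_lia.
Qed.

End Runs.

(** * The two paths do not cross *)

Section NonCrossing.
Variable sh : {fset cell}.
Hypothesis sh_conv : forall c e d : cell, c \in sh -> d \in sh ->
  cell_le c e -> cell_le e d -> e \in sh.
Hypothesis sh_pos : forall c : cell, c \in sh -> (0 < c.1) && (0 < c.2).

Variables (T : tableau) (B : {fset cell}).
Variables (a : nat) (p q : nat -> cell) (v : cell).
Let val (c : cell) : nat := (ent T c).1.
Let sw (c : cell) : cell := (c.1.+1, c.2.-1).
Let ne (c : cell) : cell := (c.1.-1, c.2.+1).

Hypothesis uB : upset sh B.
Hypothesis gB : forall c d : cell, c \in B -> d \in B -> cell_le c d ->
  ssct_rel (cvalue T) c d.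
Hypotheses (vB : v \in B) (va : val v = a).

Hypothesis q0 : q 0 = v.
Hypothesis qstep : forall m,
  [\/ q m.+1 = q m,
      [/\ q m.+1 = up (q m), up (q m) \in B &
          lf (q m) \in B -> val (up (q m)) <= (val (lf (q m))).+1]
    | [/\ q m.+1 = lf (q m), lf (q m) \in B, a <= val (lf (q m)) &
          up (q m) \in B -> (val (lf (q m))).+1 < val (up (q m))]].

Hypothesis p0 : p 0 \in sh.
Hypothesis pB : forall d : cell, d \in sh -> cell_le (p 0) d -> d != p 0 ->
  d \in B.
Hypothesis pstep : forall k,
  [\/ p k.+1 = p k,
      [/\ p k.+1 = rt (p k), rt (p k) \in sh, a < val (rt (p k)) &
          dn (p k) \in sh -> (val (dn (p k))).+1 < val (rt (p k))]
    | [/\ p k.+1 = dn (p k), dn (p k) \in sh &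
          rt (p k) \in sh -> val (rt (p k)) <= (val (dn (p k))).+1]].

Let onq (z : cell) : Prop := exists m, q m = z.

Let upedge (z : cell) : Prop :=
  onq (dn z) /\ (sw z \in B -> val z <= (val (sw z)).+1).

Let lfedge (z : cell) : Prop :=
  [/\ onq (rt z), a <= val z & ne z \in B -> (val z).+1 < val (ne z)].

Lemma onq_in z : onq z -> (z \in B) && cell_le z v.
Proof.
case=> m <-; elim: m => [|m IH]; first by rewrite q0 vB /cell_le !leqnn.
have [->//|[-> -> _]|[-> -> _ _]] := qstep m;
  by move: IH => /andP[_]; rewrite /cell_le /=; nat_lia.
Qed.

Lemma onq_pos z : onq z -> (z \in sh) && (0 < z.1) && (0 < z.2).
Proof.
move=> /onq_in /andP[zB _]; have zs : z \in sh by case: uB => + _; apply.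
by rewrite zs -andbA sh_pos.
Qed.

(** The backward path enters the row of z from below, unless it starts there;
    the cell where it enters is the rightmost one of the path in this row. *)
Lemma row_end z : onq z -> exists z' : cell,
  [/\ onq z', z'.1 = z.1, z.2 <= z'.2 & z' = v \/ upedge z'].
Proof.
case=> m; elim: m z => [|m IH] z <-.
  by exists v; split; rewrite ?q0 //; [exists 0|left].
have [->|[E UB hU]|[E LB _ _]] := qstep m; first exact: IH.
  have onm : onq (q m) by exists m.
  have := onq_pos onm => /andP[/andP[_ m1] m2].
  exists (q m.+1); split=> //; first by exists m.+1.
  rewrite E; right; split.
    by exists m; rewrite /dn /up /=; case: (q m) m1 => [[|i] j].
  suff -> : sw (up (q m)) = lf (q m) by [].
  by rewrite /sw /up /lf /=; case: (q m) m1 => [[|i] j].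
by have [z' [z1 z2 z3 z4]] := IH _ erefl; exists z'; split; rewrite ?E //=;
  nat_lia.
Qed.

Lemma col_end z : onq z -> exists z' : cell,
  [/\ onq z', z'.2 = z.2, z.1 <= z'.1 & z' = v \/ lfedge z'].
Proof.
case=> m; elim: m z => [|m IH] z <-.
  by exists v; split; rewrite ?q0 //; [exists 0|left].
have [->|[E UB hU]|[E LB aL hL]] := qstep m; first exact: IH.
  by have [z' [z1 z2 z3 z4]] := IH _ erefl; exists z'; split; rewrite ?E //=;
    nat_lia.
have onm : onq (q m) by exists m.
have := onq_pos onm => /andP[/andP[_ m1] m2].
exists (q m.+1); split=> //; first by exists m.+1.
rewrite E; right; split=> //.
  by exists m; rewrite /rt /lf /=; case: (q m) m2 => [i [|j]].
suff -> : ne (lf (q m)) = up (q m) by [].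
by rewrite /ne /up /lf /=; case: (q m) m2 => [i [|j]].
Qed.

Lemma row_reach i z : onq z -> z.1 <= i -> exists z' : cell,
  [/\ onq z', z'.1 <= i, z.2 <= z'.2 & z' = v \/ z'.1 = i /\ upedge z'].
Proof.
move: {2}(i - z.1) (leqnn (i - z.1)) => N; elim: N z => [|N IH] z hN oz zi.
all: have [z' [oz' z1 z2 [z3|z3]]] := row_end oz;
  first by exists z'; split; rewrite ?z1 //; left.
  by exists z'; split; rewrite ?z1 //; right; split=> //; lia.
have [E|E] := eqVneq z'.1 i.
  by exists z'; split=> //; [rewrite E|right].
have oD : onq (dn z') by case: z3.
have [||w [w1 w2 w3 w4]] := IH _ _ oD; rewrite /=; try lia.
by exists w; split=> //; move: w3 => /=; lia.
Qed.

Lemma col_reach j z : onq z -> z.2 <= j -> exists z' : cell,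
  [/\ onq z', z'.2 <= j, z.1 <= z'.1 & z' = v \/ z'.2 = j /\ lfedge z'].
Proof.
move: {2}(j - z.2) (leqnn (j - z.2)) => N; elim: N z => [|N IH] z hN oz zi.
all: have [z' [oz' z1 z2 [z3|z3]]] := col_end oz;
  first by exists z'; split; rewrite ?z1 //; left.
  by exists z'; split; rewrite ?z1 //; right; split=> //; lia.
have [E|E] := eqVneq z'.2 j.
  by exists z'; split=> //; [rewrite E|right].
have oD : onq (rt z') by case: z3.
have [||w [w1 w2 w3 w4]] := IH _ _ oD; rewrite /=; try lia.
by exists w; split=> //; move: w3 => /=; lia.
Qed.

Lemma p_in k : (p k \in sh) && cell_le (p 0) (p k).
Proof.
elim: k => [|k IH]; first by rewrite p0 /cell_le !leqnn.
have [->//|[-> -> _ _]|[-> -> _]] := pstep k;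
  by move: IH => /andP[_]; rewrite /cell_le /=; nat_lia.
Qed.

Lemma p_rt k : rt (p k) \in sh -> rt (p k) \in B.
Proof.
have /andP[_] := p_in k; rewrite /cell_le => le rs; apply: pB => //.
  by rewrite /cell_le /=; nat_lia.
by apply/eqP=> /(congr1 snd) /=; nat_lia.
Qed.

Lemma p_dn k : dn (p k) \in sh -> dn (p k) \in B.
Proof.
have /andP[_] := p_in k; rewrite /cell_le => le rs; apply: pB => //.
  by rewrite /cell_le /=; nat_lia.
by apply/eqP=> /(congr1 fst) /=; nat_lia.
Qed.

(** Let z be the rightmost cell of the backward path in rows not below the
    active cell of the forward path; it stays strictly to the right of the
    latter. Were the forward path to step onto the column of z, then either z
    is v, and the value found there does not exceed a, or both paths would have
    chosen (i, j) among (i, j) and (i+1, j-1). *)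
Lemma cross_left u k : onq u -> u.1 <= (p 0).1 -> (p 0).2 < u.2 ->
  (p k).2 < v.2.
Proof.
move=> ou u1 u2; suff [z [oz _ lz _]] : exists z : cell,
    [/\ onq z, z.1 <= (p k).1, (p k).2 < z.2 &
        z = v \/ z.1 = (p k).1 /\ upedge z].
  by have /andP[_] := onq_in oz; rewrite /cell_le; lia.
elim: k => [|k [z [oz z1 z2 z3]]].
  have [z [oz z1 z2 z3]] := row_reach ou u1; exists z; split=> //; lia.
have [->|[E Rs aR DR]|[E _ _]] := pstep k; first by exists z.
  exists z; split; rewrite ?E //=; rewrite ltn_neqAle z2 andbT; apply/eqP=> zR.
  case: z3 => [z3|[z3 [oD hz]]].
    subst z; have vR : cell_le v (rt (p k)) by rewrite /cell_le /=; lia.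
    have := gB vB (p_rt Rs) vR; rewrite /ssct_rel /cvalue /=.
    by move: aR va; rewrite /val /=; nat_lia.
  have Ez : z = rt (p k) by case: z z3 zR {oz z1 z2 oD hz} => ? ? /= -> <-.
  have Es : sw z = dn (p k) by rewrite Ez.
  have Ds : dn (p k) \in sh.
    have /andP[ps _] := p_in k; have /andP[/andP[Dzs _] _] := onq_pos oD.
    by apply: sh_conv ps Dzs _ _; rewrite ?Ez /cell_le /=; nat_lia.
  by move: hz (DR Ds); rewrite Es Ez => /(_ (p_dn Ds)); nat_lia.
have [|z' [oz' w1 w2 w3]] := @row_reach (p k).1.+1 z oz; first by lia.
by exists z'; rewrite E /=; split=> //; lia.
Qed.

(** The transpose of the preceding argument: z is now the lowest cell of the
    backward path in columns not to the right of the active cell, and it stays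
    strictly below, until z is v and the claim is evident. Here the forward
    path might also stop too early, but the cells of the backward path have
    values at least a and forbid it. *)
Lemma cross_right u k : onq u -> u.2 <= (p 0).2 -> (p 0).1 < u.1 ->
  (dn (p k) \in sh -> val (dn (p k)) < a) -> v.2 <= (p k).2.
Proof.
move=> ou u1 u2 stop; suff [//|[z [oz z2 lz [_ az _]]]] : v.2 <= (p k).2 \/
    exists z : cell, [/\ onq z, z.2 = (p k).2, (p k).1 < z.1 & lfedge z].
  have /andP[/andP[zs _] _] := onq_pos oz; have /andP[zB _] := onq_in oz.
  have /andP[ps _] := p_in k.
  have Ds : dn (p k) \in sh.
    by apply: sh_conv ps zs _ _; rewrite /cell_le /=; nat_lia.
  have Dz : cell_le (dn (p k)) z by rewrite /cell_le /=; nat_lia.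
  have := gB (p_dn Ds) zB Dz; rewrite /ssct_rel /cvalue /=.
  by move: (stop Ds) az; rewrite /val; nat_lia.
clear stop; elim: k => [|k [le|[z [oz z1 z2 z3]]]].
- have [z [oz z1 z2 [z3|[z3 z4]]]] := col_reach ou u1; first by left;
  rewrite -z3.
  by right; exists z; split=> //; lia.
- by left; have [->|[-> _ _ _]|[-> _ _]] := pstep k => //=; lia.
have [->|[E _ _ _]|[E Ds DR]] := pstep k; first by right; exists z.
  have [|z' [oz' w1 w2 [w3|[w3 w4]]]] := @col_reach (p k).2.+1 z oz;
    first by lia.
    by left; rewrite E /= -w3.
  by right; exists z'; rewrite E /=; split=> //; lia.
right; exists z; rewrite E /=; split=> //.
rewrite ltn_neqAle z2 andbT; apply/eqP=> zD; case: z3 => oR az hz.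
have Ez : z = dn (p k) by case: z z1 zD {oz z2 oR hz az} => ? ? /= -> <-.
have En : ne z = rt (p k) by rewrite Ez.
have Rs : rt (p k) \in sh.
  have /andP[ps _] := p_in k; have /andP[/andP[Rzs _] _] := onq_pos oR.
  by apply: sh_conv ps Rzs _ _; rewrite ?Ez /cell_le /=; nat_lia.
by move: hz (DR Rs); rewrite En Ez => /(_ (p_rt Rs)); nat_lia.
Qed.

End NonCrossing.

(** * Tails, heads and weights *)

Lemma iter_fix_le (X : Type) (f : X -> X) (x y : X) k m :
  iter k f x = y -> f y = y -> k <= m -> iter m f x = y.
Proof.
move=> E fy km; rewrite -(subnK km) iterD E; elim: (m - k) => //= l ->.
exact: fy.
Qed.

Lemma ex_min (I : eqType) (r : rel I) (s : seq I) : total r -> transitive r ->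
  s != [::] -> exists2 x, x \in s & all (r x) s.
Proof.
move=> rt tr; elim: s => // x s IH _; have rxx : r x x by have := rt x x;
  case: (r x x).
have [->|/IH[y ys yall]] := eqVneq s [::]; first by exists x;
  rewrite ?mem_head //= rxx.
case/orP: (rt x y) => h.
  exists x; rewrite ?mem_head //= rxx; apply/allP=> z /(allP yall); exact: tr.
by exists y; rewrite ?inE ?ys ?orbT //= h.
Qed.

Lemma ex_tail (T : tableau) A : A != fset0 -> exists u, istail T A u.
Proof.
move=> A0; pose r (c d : cell) := entry_le (ent T c) (ent T d) &&
   ((ent T d == ent T c) ==> (d.2 <= c.2)).
have [|||x xs /allP xall] := @ex_min _ r (enum_fset A).
- move=> c d; rewrite /r [ent T c == _]eq_sym; case: eqP => [->|ne] /=.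
    by rewrite entry_lexx /= leq_total.
  by rewrite !andbT entry_le_total.
- move=> d c e; rewrite /r => /andP[cd cd2] /andP[de de2].
  rewrite (entry_le_trans cd de) /=; apply/implyP=> /eqP ec.
  have E : ent T d = ent T c by apply: entry_le_anti => //; rewrite -ec.
  move: cd2 de2; rewrite E ec eqxx /= => h1 h2; exact: leq_trans h1.
- by apply: contraNneq A0 => h; apply/eqP/fsetP=> c;
  rewrite -[c \in A]/(c \in enum_fset A) h inE.
exists x; split=> // c cA; have /andP[h1 h2] := xall c cA; split=> // E.
by move: h2; rewrite E eqxx.
Qed.

Lemma ex_head (T : tableau) A : A != fset0 -> exists u, ishead T A u.
Proof.
move=> A0; pose r (c d : cell) := entry_le (ent T d) (ent T c) &&
   ((ent T d == ent T c) ==> (c.2 <= d.2)).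
have [|||x xs /allP xall] := @ex_min _ r (enum_fset A).
- move=> c d; rewrite /r [ent T c == _]eq_sym; case: eqP => [->|ne] /=.
    by rewrite entry_lexx /= leq_total.
  by rewrite !andbT entry_le_total.
- move=> d c e; rewrite /r => /andP[cd cd2] /andP[de de2].
  rewrite (entry_le_trans de cd) /=; apply/implyP=> /eqP ec.
  have E : ent T d = ent T c by apply: entry_le_anti => //; rewrite -ec.
  move: cd2 de2; rewrite E ec eqxx /= => h1 h2; exact: leq_trans h2.
- by apply: contraNneq A0 => h; apply/eqP/fsetP=> c;
  rewrite -[c \in A]/(c \in enum_fset A) h inE.
exists x; split=> // c cA; have /andP[h1 h2] := xall c cA; split=> // E.
by move: h2; rewrite E eqxx.
Qed.

Lemma ent_restrict (T : tableau) A c : c \in A -> ent T.[& A] c = ent T c.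
Proof. by move=> cA; rewrite /ent fnd_restrict cA. Qed.

Lemma dom_restrict (T : tableau) A : A `<=` domf T -> domf T.[& A] = A.
Proof.
move=> /fsubsetP AT; apply/fsetP=> c; rewrite domf_restrict inE.
by have [/AT->|] := boolP (c \in A).
Qed.

Lemma is_tailP (T : tableau) A u : A `<=` domf T -> u \in A ->
  reflect (istail T A u) (is_tail T.[& A] u).
Proof.
move=> AT uA; rewrite /is_tail dom_restrict //.
apply: (iffP allP) => [h|[_ h] c cA].
  split=> // c cA; have := h c cA; rewrite !ent_restrict // => /and3P[h1 h2 h3].
  by split; [rewrite /entry_le eq_sym h1 | move=> E; move: h3; rewrite E eqxx].
have [] := h c cA; rewrite !ent_restrict // /entry_le => /andP[-> h1] h2 /=.
rewrite eq_sym h1 /=; apply/implyP=> /eqP; exact: h2.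
Qed.

Lemma is_headP (T : tableau) A u : A `<=` domf T -> u \in A ->
  reflect (ishead T A u) (is_head T.[& A] u).
Proof.
move=> AT uA; rewrite /is_head dom_restrict //.
apply: (iffP allP) => [h|[_ h] c cA].
  split=> // c cA; have := h c cA; rewrite !ent_restrict // => /and3P[h1 h2 h3].
  by split; [rewrite /entry_le h1 | move=> E; move: h3; rewrite E eqxx].
have [] := h c cA; rewrite !ent_restrict // /entry_le => /andP[-> h1] h2 /=.
rewrite h1 /=; apply/implyP=> /eqP; exact: h2.
Qed.

Lemma head_filter (A : {fset cell}) (P : pred cell) u0 x : u0 \in A -> P u0 ->
  let u := head x [seq u <- A | P u] in u \in A /\ P u.
Proof.
move=> u0A Pu0 u; have : u0 \in [seq u <- A | P u] by rewrite mem_filter Pu0.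
have: forall z, z \in [seq u <- A | P u] -> z \in A /\ P z.
  by move=> z; rewrite mem_filter => /andP[].
rewrite /u; case: [seq u <- A | P u] => //= y s h _.
by apply: h; rewrite mem_head.
Qed.

Lemma tail_cellP (T : tableau) A : A `<=` domf T -> A != fset0 ->
  istail T A (tail_cell T.[& A]).
Proof.
move=> AT A0; have [u tu] := ex_tail T A0; have [uA _] := tu.
rewrite /tail_cell dom_restrict //.
have [||h1 h2] := @head_filter A (is_tail T.[& A]) u (0, 0) => //;
  first exact/is_tailP.
exact/is_tailP.
Qed.

Lemma head_cellP (T : tableau) A : A `<=` domf T -> A != fset0 ->
  ishead T A (head_cell T.[& A]).
Proof.
move=> AT A0; have [u tu] := ex_head T A0; have [uA _] := tu.
rewrite /head_cell dom_restrict //.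
have [||h1 h2] := @head_filter A (is_head T.[& A]) u (0, 0) => //;
  first exact/is_headP.
exact/is_headP.
Qed.

Definition entry_wt (e : entry) : {cmonom (nat + nat)%type} :=
  if e.2 is Some b then xvar b else yvar e.1.

Lemma wtE T : wt T = \big[mmul/mone]_(c <- domf T) entry_wt (ent T c).
Proof.
rewrite /wt [RHS]big_seq_fsetE /=; apply: eq_bigr => c _.
by rewrite /ent -[(val c)]/(fsval c) -Some_fnd /entry_wt.
Qed.

(** The weight of an entry with a finite mark does not depend on its value. *)
Lemma wt_slide Q h y k : h \in domf Q -> y \in domf Q -> h != y ->
  (ent Q y).2 != None -> wt (slide Q h y k) = wt Q.
Proof.
move=> hQ yQ hy yN; rewrite !wtE;
  have -> : domf (slide Q h y k) = domf Q by apply: domf_move.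
have yQh : y \in domf Q `\ h by rewrite !inE eq_sym hy.
rewrite !(big_fsetD1 h hQ) !(big_fsetD1 y yQh) /= !mulmA.
congr mmul; last first.
  apply: eq_big_seq => c;
    rewrite !inE ent_slide => /and3P[/negPf-> /negPf-> _] //.
rewrite !ent_slide !eqxx (negPf hy) mulmC; congr mmul.
by rewrite /entry_wt /=; case: (ent Q y).2 yN.
Qed.

(** * States of the sorting *)

Definition lht_rel (T : tableau) (c d : cell) : Prop :=
  entry_le (ent T d) (ent T c) /\ (c.1 < d.1 -> ent T c <> ent T d).

Section Sorting.
Variables (sh : {fset cell}) (n : nat).
Hypothesis sh_conv : forall c e d : cell, c \in sh -> d \in sh ->
  cell_le c e -> cell_le e d -> e \in sh.
Hypothesis sh_pos : forall c : cell, c \in sh -> (0 < c.1) && (0 < c.2).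

(** The situation between two sorting steps, alpha being the unsorted part. *)
Record sort_state (T : tableau) (alpha : {fset cell}) : Prop := SortState {
  state_dom : domf T = sh;
  state_sub : alpha `<=` sh;
  state_upset : upset sh (sh `\` alpha);
  state_ssct : forall c d : cell, c \in sh `\` alpha -> d \in sh `\` alpha ->
     cell_le c d -> ssct_rel (cvalue T) c d;
  state_bound : forall c : cell, c \in sh -> (cvalue T c < n%:Z)%R;
  state_lht : forall c d : cell, c \in alpha -> d \in alpha ->
    cell_le c d -> lht_rel T c d;
  state_sep : forall c d : cell, c \in alpha -> d \in sh `\` alpha ->
     entry_le (ent T d) (ent T c)
}.

Lemma in_sorted alpha (c : cell) : (c \in sh `\` alpha) = (c \notin alpha) &&
  (c \in sh).
Proof. exact: in_fsetD. Qed.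

Lemma unsorted_inj T alpha (c d : cell) : sort_state T alpha ->
  c \in alpha -> d \in alpha ->
  ent T c = ent T d -> c.2 = d.2 -> c = d.
Proof.
move=> g cal dal E E2; have [lt|lt|E1] := ltngtP c.1 d.1.
- have [|_] := state_lht g cal dal; first by rewrite /cell_le E2; nat_lia.
  by move=> /(_ lt).
- have [|_] := state_lht g dal cal; first by rewrite /cell_le E2; nat_lia.
  by move=> /(_ lt) [].
by case: c d E1 E2 {E cal dal} => ? ? [? ?] /= -> ->.
Qed.

Lemma sorted_inj T alpha (c d : cell) : sort_state T alpha ->
  c \in sh `\` alpha -> d \in sh `\` alpha ->
  ent T c = ent T d -> c.2 = d.2 -> c = d.
Proof.
move=> g cB dB E E2; have [lt|lt|E1] := ltngtP c.1 d.1.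
- have := state_ssct g cB dB; rewrite /ssct_rel /cvalue E /cell_le E2 leqnn;
  nat_lia.
- have := state_ssct g dB cB; rewrite /ssct_rel /cvalue E /cell_le E2 leqnn;
  nat_lia.
by case: c d E1 E2 {E cB dB} => ? ? [? ?] /= -> ->.
Qed.

Lemma in_sorted_tail alpha (u c : cell) :
  (c \in sh `\` (alpha `\ u)) = ((c == u) || (c \notin alpha)) && (c \in sh).
Proof. by rewrite in_fsetD in_fsetD1 negb_and negbK. Qed.

(** An unsorted cell after the tail would have an entry that is at most the
    minimal one, hence equal; but equal entries only continue along a row, and
    the tail is the rightmost of them. *)
Lemma tail_corner T alpha (u d : cell) : sort_state T alpha ->
  istail T alpha u ->
  d \in sh -> cell_le u d -> d != u -> d \in sh `\` alpha.
Proof.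
move=> g [ual tu] ds ud du; rewrite in_sorted ds andbT; apply/negP=> dal.
have us : u \in sh by move: ual; apply/fsubsetP/(state_sub g).
have [l1 l2] := state_lht g ual dal ud; have [t1 t2] := tu _ dal.
have E : ent T d = ent T u by apply: entry_le_anti.
have := t2 E; move: l2 ud du => + + /cell_neq; rewrite /cell_le E.
have [lt|ge] := ltnP u.1 d.1; first by move=> /(_ isT) [].
by move: ge => + _; nat_lia.
Qed.

Lemma upset_with_tail T alpha u : sort_state T alpha -> istail T alpha u ->
  upset sh (sh `\` (alpha `\ u)).
Proof.
move=> g tu; have [ual _] := tu.
split=> [c|c d]; first by rewrite in_fsetD => /andP[].
rewrite !in_sorted_tail => /andP[cB cs] ds cd; rewrite ds andbT.
have [->|du] := eqVneq d u; first by [].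
case/orP: cB => [/eqP E|cal].
  subst c; have := tail_corner g tu ds cd du.
  by rewrite in_sorted => /andP[->].
have [_ U] := state_upset g; have := U c d;
  rewrite !in_sorted cal cs /= => /(_ isT ds cd).
by case/andP=> ->.
Qed.

Lemma tail_ssct_but T alpha u : sort_state T alpha -> istail T alpha u ->
  ssct_but sh n (sh `\` (alpha `\ u)) T u.
Proof.
move=> g tu; have [ual _] := tu.
have us : u \in sh by move: ual; apply/fsubsetP/(state_sub g).
split; [exact: state_dom g|by rewrite in_sorted_tail eqxx us| |exact:
  state_bound g].
move=> c d; rewrite !in_sorted_tail => /andP[cB cs] /andP[dB ds] cu cd.
rewrite (negPf cu) /= in cB;
  have cal : c \in sh `\` alpha by rewrite in_sorted cB.
apply: (state_ssct g) => //; rewrite in_sorted ds andbT;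
  case/orP: dB => // /eqP E; subst d; exfalso.
have [_ U] := state_upset g; by have := U c u cal us cd; rewrite in_sorted ual.
Qed.

Lemma head_ssct_but T alpha v : sort_state T alpha ->
  ishead T (sh `\` alpha) v ->
  ssct_but sh n (sh `\` alpha) T v.
Proof.
move=> g [vB _]; split; [exact: state_dom g|by []| |exact: state_bound g].
by move=> c d cB dB _; apply: (state_ssct g).
Qed.

Lemma head_mark_le T alpha v : sort_state T alpha ->
  ishead T (sh `\` alpha) v ->
  forall c : cell, c \in sh -> c \notin sh `\` alpha ->
  leoo (ent T v).2 (ent T c).2.
Proof.
move=> g [vB _] c cs; rewrite in_sorted cs andbT negbK => cal.
by have /andP[] := state_sep g cal vB.
Qed.

Lemma vrun_dom T u k : u \in domf T -> domf (iter k vstep (T, u)).1 = domf T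
  /\ (iter k vstep (T, u)).2 \in domf T.
Proof.
move=> uT; elim: k => //= k; case: (iter k _ _) => Q h /= [dQ hQ].
rewrite -dQ in hQ *.
have md y k0 : y \in domf Q -> domf (slide Q h y k0) = domf Q by move=> yQ;
  apply: domf_move.
have [[_ _ ->]|[]|[]] := vstepP hQ => //.
  by move=> yQ _ _ ->; rewrite -[(_, _).1]/(slide _ _ _ _) md.
  by move=> yQ _ _ ->; rewrite -[(_, _).1]/(slide _ _ _ _) md.
Qed.

(** The path only stops at a corner of the sorted part, since the sorted cells
    above and to the left of the active one have smaller marks. *)
Lemma mjdt_end T alpha v : sort_state T alpha -> ishead T (sh `\` alpha) v ->
  let x := mjdt T v in
  [/\ mrun sh n (sh `\` alpha) T v x, lf x.2 \notin sh `\` alpha &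
      up x.2 \notin sh `\` alpha].
Proof.
move=> g hv x; have uB := state_upset g; have [vB _] := hv.
have vT : v \in domf T by rewrite (state_dom g); case: uB => + _; apply.
have out := head_mark_le g hv; have J := head_ssct_but g hv.
have bx : mrun sh n (sh `\` alpha) T v x by apply: mrun_iter.
have fx : mstep x = x by exact: mjdt_stop.
have [[]//|[E yB]|[E yB]] := mrun_step sh_conv sh_pos uB hv out bx.
all: have := fx; rewrite E => /(congr1 snd) /= Ey.
all: have /sh_pos : x.2 \in sh by case: bx => -[_ xB _ _] _ _ _;
   case: uB => + _; apply.
  by have := congr1 fst Ey => /=; nat_lia.
by have := congr1 snd Ey => /=; nat_lia.
Qed.

Lemma corner_above alpha (c u : cell) : upset sh (sh `\` alpha) ->
  u \in sh `\` alpha -> lf u \notin sh `\` alpha -> up u \notin sh `\` alpha ->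
  c \in sh -> cell_le c u -> c != u -> c \in alpha.
Proof.
move=> uB uinB L U cs cu cneq; apply/negPn/negP=> cal.
have cB : c \in sh `\` alpha by rewrite in_sorted cal.
have us : u \in sh by move: uinB; rewrite in_sorted => /andP[].
have [lt|ge] := ltnP c.1 u.1.
  have [Us cU] := upP sh_conv cs us cu lt.
  by case: uB => _ /(_ _ _ cB Us cU); rewrite (negPf U).
have [|Ls cL] := lfP sh_conv cs us cu.
  by move: cu ge cneq => + + /cell_neq; rewrite /cell_le; nat_lia.
by case: uB => _ /(_ _ _ cB Ls cL); rewrite (negPf L).
Qed.

Definition ends_apart T alpha := forall u v : cell, istail T alpha u ->
  ishead T (sh `\` alpha) v -> ent T u = ent T v -> (vjdt T u).2.2 < v.2.

Definition starts_apart T alpha := forall u v : cell, istail T alpha u ->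
  ishead T (sh `\` alpha) v -> ent T u = ent T v -> u.2 < (mjdt T v).2.2.

Lemma vjdt_end T alpha u : sort_state T alpha -> istail T alpha u ->
  let x := vjdt T u in
  [/\ vrun sh n (sh `\` (alpha `\ u)) T u x, vstep x = x,
      (rt x.2 \in sh -> (ent T (rt x.2)).1 <= (ent T u).1) &
      (dn x.2 \in sh -> (ent T (dn x.2)).1 < (ent T u).1)].
Proof.
move=> g tu x; have [ual _] := tu.
have uT : u \in domf T.
  by rewrite (state_dom g); move: ual; apply/fsubsetP/(state_sub g).
have uB := upset_with_tail g tu; have J := tail_ssct_but g tu.
have fx : vrun sh n (sh `\` (alpha `\ u)) T u x by apply: vrun_iter.
have vx : vstep x = x by exact: vjdt_stop.
have [[]//|[]|[]] := vrun_step sh_conv uB fx; rewrite vx => /(congr1 snd) /= E.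
  by have := congr1 snd E => /=; nat_lia.
by have := congr1 fst E => /=; nat_lia.
Qed.

(** The tail is a corner of the unsorted part and the end w of the path of the
    head is a corner of the sorted part, so that their columns and their rows
    are ordered in opposite ways; this puts the path of the tail on a definite
    side of the path of the head, where it stays. *)
Lemma ends_starts_apart T alpha : sort_state T alpha ->
  ends_apart T alpha <-> starts_apart T alpha.
Proof.
move=> g; suff H u v : istail T alpha u -> ishead T (sh `\` alpha) v ->
    ent T u = ent T v -> (vjdt T u).2.2 < v.2 <-> u.2 < (mjdt T v).2.2.
  by split=> h u v h1 h2 h3; apply/H => //; apply: h.
move=> tu hv E; have [ual tu2] := tu; have [vB hv2] := hv.
have us : u \in sh by move: ual; apply/fsubsetP/(state_sub g).
have uB := state_upset g; have uB' := upset_with_tail g tu.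
have [bw Lw Uw] := mjdt_end g hv; set w := (mjdt T v).2 in bw Lw Uw *.
have [fx vx Rx Dx] := vjdt_end g tu.
have out := head_mark_le g hv.
pose p k := (iter k vstep (T, u)).2; pose q k := (iter k mstep (T, v)).2.
have qs m : [\/ q m.+1 = q m,
      [/\ q m.+1 = up (q m), up (q m) \in sh `\` alpha &
          lf (q m) \in sh `\` alpha ->
          (ent T (up (q m))).1 <= (ent T (lf (q m))).1.+1]
    | [/\ q m.+1 = lf (q m), lf (q m) \in sh `\` alpha,
          (ent T v).1 <= (ent T (lf (q m))).1 &
          up (q m) \in sh `\` alpha ->
          (ent T (lf (q m))).1.+1 < (ent T (up (q m))).1]].
  rewrite /q iterS.
  have bm : mrun sh n (sh `\` alpha) T v (iter m mstep (T, v)).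
    by apply: mrun_iter => //; exact: head_ssct_but.
  have [[-> _ _]|[-> h1 h2 h3 _]|[-> h1 h2 h3 _]] :=
    mrun_step sh_conv sh_pos uB hv out bm.
  - by constructor 1.
  - by constructor 2.
  - by constructor 3.
have ps k : [\/ p k.+1 = p k,
      [/\ p k.+1 = rt (p k), rt (p k) \in sh,
          (ent T v).1 < (ent T (rt (p k))).1 &
          dn (p k) \in sh ->
          (ent T (dn (p k))).1.+1 < (ent T (rt (p k))).1]
    | [/\ p k.+1 = dn (p k), dn (p k) \in sh &
          rt (p k) \in sh ->
          (ent T (rt (p k))).1 <= (ent T (dn (p k))).1.+1]].
  rewrite /p iterS -E.
  have fm : vrun sh n (sh `\` (alpha `\ u)) T u (iter k vstep (T, u)).
    by apply: vrun_iter => //; exact: tail_ssct_but.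
  have [[-> _ _]|[-> h1 h2 h3 _]|[-> h1 h2 h3 _]] := vrun_step sh_conv uB' fm.
  - by constructor 1.
  - by constructor 2.
  - by constructor 3.
have pB (d : cell) : d \in sh -> cell_le (p 0) d -> d != p 0 ->
  d \in sh `\` alpha.
  by move=> ds ud du; exact: (tail_corner g tu ds ud du).
have ow : exists m, q m = w by exists #|` domf T|.
have Ex : (vjdt T u).2 = p #|` domf T| by [].
have gB := state_ssct g.
have wB : w \in sh `\` alpha by case: bw => -[].
have ws : w \in sh by move: wB; rewrite in_sorted => /andP[].
split=> lt.
- rewrite ltnNge; apply/negP=> wu; move: lt; rewrite ltnNge => /negP; apply.
  have w1 : u.1 < w.1.
    rewrite ltnNge; apply/negP=> h.
    have [_ /(_ w u wB us)] := uB; rewrite in_sorted ual /cell_le h wu.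
    by move/(_ isT).
  rewrite Ex; apply: (cross_right sh_conv sh_pos (a := (ent T v).1) uB gB vB
     (q := q) (p := p)) ow wu w1 _ => //.
  by rewrite -Ex -E.
- have w1 : w.1 <= u.1.
    rewrite leqNgt; apply/negP=> h.
    pose e : cell := (u.1, w.2).
    have ue : cell_le u e by rewrite /cell_le /=; nat_lia.
    have ew : cell_le e w by rewrite /cell_le /=; nat_lia.
    have es : e \in sh by apply: sh_conv ue ew.
    have eal : e \in alpha.
      apply: (corner_above uB wB Lw Uw es ew).
      by apply/eqP=> /(congr1 fst) /=; nat_lia.
    have [l1 _] := state_lht g ual eal ue; have [t1 t2] := tu2 _ eal.
    have /t2 : ent T e = ent T u by apply: entry_le_anti.
    by rewrite /e /=; nat_lia.
rewrite Ex; exact: (@cross_left sh sh_conv sh_pos T (sh `\` alpha) (ent T v).1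
     p q v uB gB vB erefl erefl qs us pB ps w _ ow w1 lt).
Qed.

(** What is needed of a run in order to compare the cells of B with the active
    entry afterwards: the displaced entries change their values, but their
    marks stay below the active one. *)
Definition passed_small (B : {fset cell}) (T : tableau) (u : cell)
    (x : tableau * cell) : Prop :=
  forall d : cell, d \in B -> [\/ d = x.2, ltoo (ent x.1 d).2 (ent T u).2 |
     d <> u /\ ent x.1 d = ent T d].

Lemma passed_small_slide B T u Q h y k : passed_small B T u (Q, h) ->
  ltoo (ent Q y).2 (ent T u).2 -> passed_small B T u (slide Q h y k, y).
Proof.
move=> tQ lt d dB /=; rewrite ent_slide.
case: eqP => [->|dy]; first by constructor 1.
case: eqP => [->|dh]; first by constructor 2.
by case: (tQ d dB) => [/dh []|h1|h1]; [constructor 2|constructor 3].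
Qed.

Lemma vrun_monotone T u k m : u \in domf T -> k <= m ->
  cell_le (iter k vstep (T, u)).2 (iter m vstep (T, u)).2.
Proof.
move=> uT km; rewrite -(subnK km) iterD; move: (iter k _ _) (vrun_dom k uT).
move=> x [dx xT]; elim: (m - k) => [|l IH] /=; first by rewrite /cell_le !leqnn.
have : (iter l vstep x).2 \in domf (iter l vstep x).1.
  case: x dx xT {IH} => Q h /= dQ; rewrite -dQ => hQ.
  by have [-> ->] := vrun_dom l hQ.
case: (iter l vstep x) IH => Q h /= xh hQ; apply: cell_le_trans xh _.
have [[_ _ ->]|[_ _ _ ->]|[_ _ _ ->]] := vstepP hQ => /=;
  rewrite /cell_le /=; nat_lia.
Qed.

Lemma ltoo_neq (r s : natoo) : ltoo r s -> r != None.
Proof. by case: r s => [?|] [?|]. Qed.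

(** The passed entries have smaller marks: an entry with the mark of the tail
    has at most its value, so it can only be passed when it is equal and lies
    below the active cell; but by [ends_apart] the path ends strictly left of
    all equal sorted entries. Hence the run can be undone, and the inserted
    entry is the head. *)
Lemma vjdt_state T alpha u : sort_state T alpha -> ends_apart T alpha ->
  istail T alpha u ->
  let x := vjdt T u in let alpha' := alpha `\ u in
  [/\ sort_state x.1 alpha', ends_apart x.1 alpha',
    ishead x.1 (sh `\` alpha') x.2,
      mjdt x.1 x.2 = (T, u) & wt x.1 = wt T].
Proof.
move=> g cC tu x alpha'; have [ual tu2] := tu.
have us : u \in sh by move: ual; apply/fsubsetP/(state_sub g).
have uT : u \in domf T by rewrite (state_dom g).
have uB := state_upset g;
  have uB' : upset sh (sh `\` alpha') := upset_with_tail g tu.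
have J0 : ssct_but sh n (sh `\` alpha') T u := tail_ssct_but g tu.
have [fx vx Rx Dx] : [/\ vrun sh n (sh `\` alpha') T u x, vstep x = x,
    rt x.2 \in sh -> (ent T (rt x.2)).1 <= (ent T u).1
  & dn x.2 \in sh -> (ent T (dn x.2)).1 < (ent T u).1] by exact: vjdt_end.
have B'P (d : cell) : d \in sh `\` alpha' -> d = u \/ d \in sh `\` alpha.
  rewrite in_sorted_tail => /andP[/orP[/eqP->|dal] ds]; first by left.
  by right; rewrite in_sorted dal.
have out' (c : cell) : c \in sh -> c \notin sh `\` alpha' -> c \in alpha'.
  by move=> cs; rewrite in_sorted cs andbT negbK.
have out (c : cell) : c \in sh -> c \notin sh `\` alpha' ->
    leoo (ent T u).2 (ent T c).2.
  by move=> cs /(out' _ cs); rewrite in_fsetD1 => /andP[_ /tu2[/andP[]]].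
(* an equal sorted entry c passed downwards lies in a column weakly left of the
   end of the path, hence strictly left of the head, which is the leftmost *)
have pass k : k < #|` domf T| -> let y := iter k vstep (T, u) in
    (vstep y).2 != y.2 -> ltoo (ent T (vstep y).2).2 (ent T u).2.
  move=> kN y; have fy : vrun sh n (sh `\` alpha') T u y by apply: vrun_iter.
  have last : cell_le (vstep y).2 x.2 by rewrite -iterS; apply: vrun_monotone.
  have main (c : cell) : c \in sh -> cell_le u c -> c != u -> cell_le c x.2 ->
      (ent T u).1 <= (ent T c).1 ->
      ((ent T u).1 < (ent T c).1 \/ c.2 <= x.2.2) ->
        ltoo (ent T c).2 (ent T u).2.
    move=> cs uc cu cx le alt; have cB := tail_corner g tu cs uc cu.
    have se := state_sep g ual cB; rewrite /ltoo; apply/negP=> ge.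
    have Em : (ent T c).2 = (ent T u).2 by apply: leoo_anti => //;
      case/andP: se.
    have ca : (ent T c).1 <= (ent T u).1.
      by move: se; rewrite /entry_le Em eqxx => /andP[].
    case: alt => [|c2]; first by rewrite ltnNge ca.
    have Ec : ent T c = ent T u.
      rewrite [LHS]surjective_pairing [RHS]surjective_pairing Em.
      by congr pair; apply/eqP; rewrite eqn_leq ca le.
    have [v0 hv0] : exists v, ishead T (sh `\` alpha) v.
      by apply: ex_head; apply/fset0Pn; exists c.
    have [v0B hv02] := hv0; have [h1 h2] := hv02 _ cB.
    have Ev : ent T u = ent T v0.
      apply: entry_le_anti; first by rewrite -Ec.
      exact: (state_sep g ual v0B).
    have := cC _ _ tu hv0 Ev; rewrite -/x; have := h2 (etrans Ec Ev).
    by move: c2; nat_lia.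
  have uy : cell_le u y.2 by case: fy.
  have [[->]|[E ys h1 _ _]|[E ys h1 _ _]] := vrun_step sh_conv uB' fy;
    first by rewrite eqxx.
  - rewrite E /= => _; rewrite E /= in last; apply: main => //.
    + by move: uy; rewrite /cell_le /=; nat_lia.
    + by apply/eqP=> /(congr1 snd) /=; move: uy; rewrite /cell_le; nat_lia.
    + exact: ltnW.
    + by left.
  - rewrite E /= => _; rewrite E /= in last; apply: main => //.
    + by move: uy; rewrite /cell_le /=; nat_lia.
    + by apply/eqP=> /(congr1 fst) /=; move: uy; rewrite /cell_le; nat_lia.
    + by right; case/andP: last.
have run k : k <= #|` domf T| -> let y := iter k vstep (T, u) in
    [/\ exists2 l, l <= k & iter l mstep y = (T, u), wt y.1 = wt T
      & passed_small (sh `\` alpha') T u y].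
  elim: k => [_|k IH kN].
    split=> //; first by exists 0.
    by move=> d dB; have [->|/eqP] := eqVneq d u; [constructor 1|constructor 3].
  have /= [[l lk El] Ew tt] := IH (ltnW kN).
  set y := iter k vstep (T, u) in El Ew tt *; rewrite /=.
  have ps : (vstep y).2 != y.2 -> ltoo (ent T (vstep y).2).2 (ent T u).2.
    exact: pass _ kN.
  have fy : vrun sh n (sh `\` alpha') T u y by apply: vrun_iter.
  have rv := vstep_undone sh_conv sh_pos uB' J0 fy out ps.
  have same : vstep y = y ->
    [/\ exists2 l, l <= k.+1 & iter l mstep (vstep y) = (T, u),
      wt (vstep y).1 = wt T & passed_small (sh `\` alpha') T u (vstep y)].
    by move=> ->; split=> //; exists l => //; exact: leqW.
  have inv : mstep (vstep y) = y ->
    exists2 l, l <= k.+1 & iter l mstep (vstep y) = (T, u).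
    by move=> E; exists l.+1; rewrite ?ltnS // iterSr E.
  case: rv => [/same//|E']; have {}inv := inv E'.
  have ly (c : cell) : c.1 + c.2 > y.2.1 + y.2.2 -> ent y.1 c = ent T c.
    by move=> lt; case: fy => _ _ _; apply; move: lt; rewrite /cell_le; nat_lia.
  have [ydom yB _ _] : ssct_but sh n (sh `\` alpha') y.1 y.2 by case: fy.
  have yin : y.2 \in sh by case: uB' => + _; apply.
  have [[/same//]|[E ys h1 _ _]|[E ys h1 _ _]] := vrun_step sh_conv uB' fy.
  - have yR : y.2 != rt y.2 by apply/eqP=> /(congr1 snd) /=; nat_lia.
    have lt : ltoo (ent y.1 (rt y.2)).2 (ent T u).2.
      by rewrite ly /=; [move: ps; rewrite E /= eq_sym; apply|nat_lia].
    split=> //; rewrite E.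
      by rewrite wt_slide ?ydom //; exact: ltoo_neq lt.
    by apply: passed_small_slide lt; rewrite -surjective_pairing.
  - have yR : y.2 != dn y.2 by apply/eqP=> /(congr1 fst) /=; nat_lia.
    have lt : ltoo (ent y.1 (dn y.2)).2 (ent T u).2.
      by rewrite ly /=; [move: ps; rewrite E /= eq_sym; apply|nat_lia].
    split=> //; rewrite E.
      by rewrite wt_slide ?ydom //; exact: ltoo_neq lt.
    by apply: passed_small_slide lt; rewrite -surjective_pairing.
have /= [[l lN El] Ew tt] := run _ (leqnn _);
  rewrite -/(vjdt T u) -/x in El Ew tt.
have [J ux aE same] := fx; have [dx xB G bnd] := J.
have xs : x.2 \in sh by case: uB' => + _; apply.
have top (d : cell) : d \in sh `\` alpha' -> entry_le (ent x.1 d) (ent T u) /\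
    (ent x.1 d = ent T u ->
      d = x.2 \/ (d \in sh `\` alpha /\ ent T d = ent T u)).
  move=> dB; case: (tt _ dB) => [->|lt|[du Ed]].
  - by rewrite aE entry_lexx; split=> // _; left.
  - split; last by move=> E; move: lt; rewrite E /ltoo leooxx.
    have le : leoo (ent x.1 d).2 (ent T u).2.
      have := leoo_total (ent x.1 d).2 (ent T u).2.
      by move: lt; rewrite /ltoo => /negPf ->; rewrite orbF.
    rewrite /entry_le le /=; apply/implyP=> /eqP Em; move: lt.
    by rewrite /ltoo Em leooxx.
  - have dB0 : d \in sh `\` alpha by case: (B'P _ dB).
    rewrite Ed; split; first exact: (state_sep g ual dB0).
    by move=> E; right.
have eal (c : cell) : c \in alpha' -> ent x.1 c = ent T c.
  move=> cal; have cs : c \in sh.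
    by apply: (fsubsetP (state_sub g)); move: cal; rewrite in_fsetD1 => /andP[].
  by apply: (vrun_out uB' J0 fx cs); rewrite in_sorted cal.
have sub c : c \in alpha' -> c \in alpha by rewrite in_fsetD1 => /andP[].
have g' : sort_state x.1 alpha'.
  split=> //.
  - apply/fsubsetP=> c /sub; exact/fsubsetP/(state_sub g).
  - have h1 : rt x.2 \in sh -> (ent x.1 (rt x.2)).1 <= (ent x.1 x.2).1.
      by move=> h; rewrite aE same ?Rx // /cell_le /=; nat_lia.
    have h2 : dn x.2 \in sh -> (ent x.1 (dn x.2)).1 < (ent x.1 x.2).1.
      by move=> h; rewrite aE same ?Dx // /cell_le /=; nat_lia.
    exact: (ssct_but_stop sh_conv uB' J h1 h2).
  - move=> c d cal dal cd; rewrite /lht_rel !eal //.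
    exact: (state_lht g (sub _ cal) (sub _ dal) cd).
  - move=> c d cal dB; rewrite (eal c) //; apply: entry_le_trans (top _ dB).1 _.
    by have [] := tu2 _ (sub _ cal).
have hx : ishead x.1 (sh `\` alpha') x.2.
  split=> // c cB; have [t1 t2] := top _ cB; rewrite aE; split=> //.
  move=> /t2 [->//|[cB0 Ec]].
  have [v0 hv0] : exists v, ishead T (sh `\` alpha) v.
    by apply: ex_head; apply/fset0Pn; exists c.
  have [v0B hv02] := hv0; have [h1 h2] := hv02 _ cB0.
  have Ev : ent T u = ent T v0.
    by apply: entry_le_anti; [rewrite -Ec | exact: (state_sep g ual v0B)].
  have := cC _ _ tu hv0 Ev; rewrite -/x; have := h2 (etrans Ec Ev).
  by nat_lia.
have Emj : mjdt x.1 x.2 = (T, u).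
  rewrite /mjdt -surjective_pairing; apply: iter_fix_le El _ _; last first.
    by rewrite dx -(state_dom g).
  (* the slide back stops at u, since all cells before u are unsorted and
     their marks are at least that of the tail *)
  have outu (c : cell) : c \in sh -> cell_le c u -> c != u ->
      leoo (ent T u).2 (ent T c).2.
    move=> cs cu cneq; apply: out => //;
      rewrite in_sorted cs andbT negbK in_fsetD1 cneq.
    apply/negPn/negP=> cal;
      have cB : c \in sh `\` alpha by rewrite in_sorted cal.
    by have [_ /(_ c u cB us cu)] := uB; rewrite in_sorted ual.
  have up0 := sh_pos us; have [[]//|[ys]|[ys]] := mstepP uT;
    rewrite (state_dom g) in ys.
    move=> lt; move: lt; rewrite /ltoo outu //; first by rewrite /cell_le /=;
      nat_lia.
    by apply/eqP=> /(congr1 fst) /=; move: up0; nat_lia.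
  move=> lt; move: lt; rewrite /ltoo outu //; first by rewrite /cell_le /=;
    nat_lia.
  by apply/eqP=> /(congr1 snd) /=; move: up0; nat_lia.
split=> //; apply/ends_starts_apart => // u2 v2 tu' hv' E.
have Ev : v2 = x.2.
  have [v2B h1] := hv'; have [_ h2] := hx.
  have [e1 m1] := h1 _ xB; have [e2 m2] := h2 _ v2B.
  have Ee : ent x.1 v2 = ent x.1 x.2 by exact: entry_le_anti.
  apply: (sorted_inj g' v2B xB Ee); apply/eqP.
  by rewrite eqn_leq (m1 (esym Ee)) (m2 Ee).
subst v2; rewrite Emj /=; have [u2al _] := tu'.
have [_ le] := tu2 _ (sub _ u2al).
have E2 : ent T u2 = ent T u by rewrite -eal // E aE.
rewrite ltn_neqAle le // andbT; apply/eqP=> E3.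
have := unsorted_inj g (sub _ u2al) ual E2 E3 => E4.
by move: u2al; rewrite E4 in_fsetD1 eqxx.
Qed.

(** Here [starts_apart] is what makes the extracted entry the rightmost of the
    equal ones, in particular not placed below one of them in its column. *)
Lemma mjdt_state T alpha v : sort_state T alpha -> starts_apart T alpha ->
  ishead T (sh `\` alpha) v ->
  let x := mjdt T v in let alpha' := x.2 |` alpha in
  [/\ sort_state x.1 alpha', ends_apart x.1 alpha', istail x.1 alpha' x.2 &
      vjdt x.1 x.2 = (T, v)].
Proof.
move=> g cC hv x alpha'; have [vB hv2] := hv.
have uB := state_upset g; have out := head_mark_le g hv.
have vs : v \in sh by move: vB; rewrite in_sorted => /andP[].
have vT : v \in domf T by rewrite (state_dom g).
have J0 := head_ssct_but g hv.
have [bx Lx Ux] : [/\ mrun sh n (sh `\` alpha) T v x,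
   lf x.2 \notin sh `\` alpha & up x.2 \notin sh `\` alpha] by exact: mjdt_end.
have run k : let y := iter k mstep (T, v) in
    (exists2 l, l <= k & iter l vstep y = (T, v)) /\
    passed_small (sh `\` alpha) T v y.
  elim: k => [|k IH].
    split; first by exists 0.
    by move=> d dB; have [->|/eqP] := eqVneq d v; [constructor 1|constructor 3].
  have /= [[l lk El] tt] := IH.
  set y := iter k mstep (T, v) in El tt *; rewrite /=.
  have byy : mrun sh n (sh `\` alpha) T v y by apply: mrun_iter.
  have same : mstep y = y ->
      (exists2 l, l <= k.+1 & iter l vstep (mstep y) = (T, v)) /\
      passed_small (sh `\` alpha) T v (mstep y).
    by move=> ->; split=> //; exists l => //; exact: leqW.
  have inv : vstep (mstep y) = y ->
      exists2 l, l <= k.+1 & iter l vstep (mstep y) = (T, v).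
    by move=> E; exists l.+1; rewrite ?ltnS // iterSr E.
  have [/same//|E'] := mstep_undone sh_conv sh_pos uB hv out byy.
  have {}inv := inv E'.
  have [_ yB _ _] : ssct_but sh n (sh `\` alpha) y.1 y.2 by case: byy.
  have /sh_pos y0 : y.2 \in sh by case: uB => + _; apply.
  have ly (c : cell) : c.1 + c.2 < y.2.1 + y.2.2 -> ent y.1 c = ent T c.
    by move=> lt; case: byy => _ _ _; apply; move: lt; rewrite /cell_le;
      nat_lia.
  have [[/same//]|[E ys h1 _ _]|[E ys h1 _ _]] :=
    mrun_step sh_conv sh_pos uB hv out byy.
  - have lt : ltoo (ent y.1 (up y.2)).2 (ent T v).2.
      rewrite ly /=; last by nat_lia.
      by apply: (mrun_passed uB hv byy) => //=; rewrite /cell_le /=; nat_lia.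
    split=> //; rewrite E.
    by apply: passed_small_slide lt; rewrite -surjective_pairing.
  - have lt : ltoo (ent y.1 (lf y.2)).2 (ent T v).2.
      rewrite ly /=; last by nat_lia.
      by apply: (mrun_passed uB hv byy) => //=; rewrite /cell_le /=; nat_lia.
    split=> //; rewrite E.
    by apply: passed_small_slide lt; rewrite -surjective_pairing.
have /= [[l lN El] tt] := run #|` domf T|.
rewrite -/(mjdt T v) -/x in El tt.
have [J xv aE same] := bx; have [dx xB G bnd] := J.
have xs : x.2 \in sh by move: xB; rewrite in_sorted => /andP[].
have xal : x.2 \notin alpha by move: xB; rewrite in_sorted => /andP[].
have eal (c : cell) : c \in alpha -> ent x.1 c = ent T c.
  move=> cal; apply: same; apply/negP=> /andP[xc cv].
  have cs : c \in sh by move: cal; apply/fsubsetP/(state_sub g).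
  by case: uB => _ /(_ _ _ xB cs xc); rewrite in_sorted cal.
have B'P (d : cell) : d \in sh `\` alpha' -> d != x.2 /\ d \in sh `\` alpha.
  by rewrite in_fsetD in_fset1U negb_or in_sorted => /andP[/andP[-> ->] ->].
have top (d : cell) : d \in sh `\` alpha' -> entry_le (ent x.1 d) (ent T v) /\
    (ent x.1 d = ent T v ->
     [/\ d != v, d \in sh `\` alpha & ent T d = ent T v]).
  move=> /B'P[dx2 dB]; case: (tt _ dB) => [E|lt|[/eqP du Ed]].
  - by rewrite E eqxx in dx2.
  - split; last by move=> E; move: lt; rewrite E /ltoo leooxx.
    have le : leoo (ent x.1 d).2 (ent T v).2.
      have := leoo_total (ent x.1 d).2 (ent T v).2.
      by move: lt; rewrite /ltoo => /negPf ->; rewrite orbF.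
    rewrite /entry_le le /=; apply/implyP=> /eqP Em; move: lt.
    by rewrite /ltoo Em leooxx.
  - by rewrite Ed; split; [case: (hv2 _ dB) | split].
(* the tail of T is the rightmost of the unsorted entries equal to the active
   one, so that starts_apart applies to all of them *)
have left_of (c : cell) : c \in alpha -> ent T c = ent T v -> c.2 < x.2.2.
  move=> cal Ec; have [u0 tu0] : exists u, istail T alpha u.
    by apply: ex_tail; apply/fset0Pn; exists c.
  have [u0al h] := tu0; have [h1 h2] := h _ cal.
  have Eu : ent T u0 = ent T v.
    by apply: entry_le_anti; [rewrite -Ec | exact: (state_sep g u0al vB)].
  have := cC _ _ tu0 hv Eu; rewrite -/x; have := h2 (etrans Ec (esym Eu)).
  by nat_lia.
have uB' : upset sh (sh `\` alpha').
  split=> [c|c d]; first by rewrite in_fsetD => /andP[].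
  move=> /B'P[cx cB] ds cd; have [_ /(_ _ _ cB ds cd)] := uB.
  rewrite !in_sorted in_fset1U negb_or ds !andbT => -> /=; rewrite andbT.
  apply/eqP=> E; rewrite E in cd.
  move: cB; rewrite in_sorted => /andP[/negPf cal cs].
  by have := corner_above uB xB Lx Ux cs cd cx; rewrite cal.
have g' : sort_state x.1 alpha'.
  split=> //.
  - apply/fsubsetP=> c; rewrite in_fset1U => /orP[/eqP->//|].
    exact/fsubsetP/(state_sub g).
  - by move=> c d /B'P[cx cB] /B'P[_ dB] cd; apply: G.
  - move=> c d; rewrite !in_fset1U => /orP[/eqP->|cal] /orP[/eqP->|dal] cd.
    + by split; [exact: entry_lexx|rewrite ltnn].
    + have ds : d \in sh by move: dal; apply/fsubsetP/(state_sub g).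
      by case: uB => _ /(_ _ _ xB ds cd); rewrite in_sorted dal.
    + rewrite /lht_rel (eal c) // aE; split; first exact: (state_sep g cal vB).
      move=> lt Ec.
      (* were c equal to the extracted entry, the unsorted cell e in its row
         and in the column of the new cell would be equal to it as well *)
      pose e : cell := (c.1, x.2.2).
      have cs : c \in sh by move: cal; apply/fsubsetP/(state_sub g).
      have ce : cell_le c e by move: cd; rewrite /cell_le /=; nat_lia.
      have ex : cell_le e x.2 by move: cd; rewrite /cell_le /=; nat_lia.
      have es : e \in sh by apply: sh_conv ce ex.
      have eal2 : e \in alpha.
        apply: (corner_above uB xB Lx Ux es ex).
        by apply/eqP=> /(congr1 fst) /=; nat_lia.
      have [l1 _] := state_lht g cal eal2 ce; have l2 := state_sep g eal2 vB.
      have /(left_of _ eal2) : ent T e = ent T v.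
        by apply: entry_le_anti => //; rewrite -Ec.
      by rewrite /e /= ltnn.
    + by rewrite /lht_rel !eal //; exact: (state_lht g cal dal cd).
  - move=> c d; rewrite in_fset1U => /orP[/eqP->|cal] dB.
      by rewrite aE; exact: (top _ dB).1.
    rewrite (eal c) //; apply: entry_le_trans (top _ dB).1 _.
    exact: (state_sep g cal vB).
have tx : istail x.1 alpha' x.2.
  split; first by rewrite in_fset1U eqxx.
  move=> c; rewrite in_fset1U aE => /orP[/eqP->|cal];
    first by rewrite aE entry_lexx.
  rewrite eal //; split; first exact: (state_sep g cal vB).
  by move=> /(left_of _ cal)/ltnW.
have Evj : vjdt x.1 x.2 = (T, v).
  rewrite /vjdt -surjective_pairing; apply: iter_fix_le El _ _; last first.
    by rewrite dx -(state_dom g).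
  (* the forward slide stops at v by the content conditions of T around v *)
  have gr (c : cell) : c \in sh -> cell_le v c -> ssct_rel (cvalue T) v c.
    by move=> cs vc; apply: (state_ssct g vB) => //; case: uB => _; apply;
      first exact: vB.
  have [[]//|[ys]|[ys]] := vstepP vT; rewrite (state_dom g) in ys.
    have := gr _ ys; rewrite /ssct_rel /cvalue /cell_le /=; nat_lia.
  have := gr _ ys; rewrite /ssct_rel /cvalue /cell_le /=; nat_lia.
split=> // u2 v2 tu' hv' E; have [u2al h1] := tu'; have [v2B h2] := hv'.
have [xal2 h3] := tx.
have Eu : u2 = x.2.
  have [e1 m1] := h1 _ xal2; have [e2 m2] := h3 _ u2al.
  have Ee : ent x.1 u2 = ent x.1 x.2 by exact: entry_le_anti.
  apply: (unsorted_inj g' u2al xal2 Ee); apply/eqP.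
  by rewrite eqn_leq (m1 (esym Ee)) (m2 Ee).
subst u2; rewrite Evj /=; have [_ t2] := top _ v2B.
have [v2v v2B0 Ev2] := t2 (etrans (esym E) aE).
have [_ le] := hv2 _ v2B0.
rewrite ltn_neqAle (le Ev2) andbT; apply/eqP=> E3.
by move: v2v; rewrite (sorted_inj g v2B0 vB Ev2 (esym E3)) eqxx.
Qed.

Lemma tail_unique T alpha u : sort_state T alpha -> istail T alpha u ->
  tail_cell T.[& alpha] = u.
Proof.
move=> g tu; have [ual h] := tu.
have al0 : alpha != fset0 by apply/fset0Pn; exists u.
have aT : alpha `<=` domf T by rewrite (state_dom g) (state_sub g).
have [ual' h'] := tail_cellP aT al0.
have [e1 m1] := h _ ual'; have [e2 m2] := h' _ ual.
have E : ent T (tail_cell T.[& alpha]) = ent T u by exact: entry_le_anti.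
apply: (unsorted_inj g ual' ual E); apply/eqP.
by rewrite eqn_leq (m1 E) (m2 (esym E)).
Qed.

Lemma head_unique T alpha v : sort_state T alpha -> ishead T (sh `\` alpha) v ->
  head_cell T.[& sh `\` alpha] = v.
Proof.
move=> g tu; have [ual h] := tu.
have B0 : sh `\` alpha != fset0 by apply/fset0Pn; exists v.
have BT : sh `\` alpha `<=` domf T by rewrite (state_dom g) fsubsetDl.
have [ual' h'] := head_cellP BT B0.
have [e1 m1] := h _ ual'; have [e2 m2] := h' _ ual.
have E : ent T (head_cell T.[& sh `\` alpha]) = ent T v by exact: entry_le_anti.
apply: (sorted_inj g ual' ual E); apply/eqP.
by rewrite eqn_leq (m1 E) (m2 (esym E)).
Qed.

(** Value-sorting records the unsorted cells and mark-sorting the sorted ones.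
    *)
Definition swap_parts (x : tableau * {fset cell}) := (x.1, sh `\` x.2).

Lemma fsetDDK alpha : alpha `<=` sh -> sh `\` (sh `\` alpha) = alpha.
Proof.
move=> /fsubsetP s; apply/fsetP=> c; rewrite !in_fsetD negb_and negbK.
by have [/s ->|] := boolP (c \in alpha); rewrite ?andbT //= andNb.
Qed.

Lemma vsort_step_state x : sort_state x.1 x.2 -> ends_apart x.1 x.2 ->
  x.2 != fset0 ->
  let y := vsort_step x in
  [/\ sort_state y.1 y.2, ends_apart y.1 y.2, #|` y.2|.+1 = #|` x.2|,
      msort_step (swap_parts y) = swap_parts x & wt y.1 = wt x.1].
Proof.
case: x => T alpha /= g c al0; have tu : istail T alpha (tail_cell T.[& alpha]).
  by apply: tail_cellP; rewrite // (state_dom g) (state_sub g).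
set u := tail_cell _ in tu *.
have [g' c' h' E' w'] := vjdt_state g c tu; have [ual _] := tu.
split=> //; first by rewrite (cardfsD1 u alpha) ual.
rewrite /msort_step /swap_parts /= (head_unique g' h') E' /=.
congr (_, _); apply/fsetP=> d; rewrite in_fsetD1 in_sorted_tail in_fsetD.
have [->|_] := eqVneq d u; first by rewrite ual.
by [].
Qed.

Lemma msort_step_state x : sort_state x.1 x.2 -> ends_apart x.1 x.2 ->
  sh `\` x.2 != fset0 ->
  exists y, [/\ msort_step (swap_parts x) = swap_parts y, sort_state y.1 y.2,
    ends_apart y.1 y.2,
      #|` sh `\` y.2|.+1 = #|` sh `\` x.2| & vsort_step y = x].
Proof.
case: x => T alpha /= g c al0;
  have hv : ishead T (sh `\` alpha) (head_cell T.[& sh `\` alpha]).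
  by apply: head_cellP; rewrite // (state_dom g) fsubsetDl.
set v := head_cell _ in hv *.
have cm : starts_apart T alpha by apply/ends_starts_apart.
have [g' c' t' E'] := mjdt_state g cm hv; set w := mjdt T v in g' c' t' E' *.
have [[_ wB _ _] _ _ _] : mrun sh n (sh `\` alpha) T v w by have [] :=
  mjdt_end g hv.
have EB : sh `\` (w.2 |` alpha) = (sh `\` alpha) `\ w.2.
  by apply/fsetP=> d; rewrite !in_fsetD in_fset1U in_fset1 negb_or andbA.
exists (w.1, w.2 |` alpha); split=> //=.
- rewrite -/v -/w /swap_parts /= EB; case: (w) => //.
- by rewrite EB (cardfsD1 w.2 (sh `\` alpha)) wB.
rewrite (tail_unique g' t') E' /=; congr (_, _); apply: fsetU1K.
by move: wB; rewrite in_sorted => /andP[].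
Qed.

Lemma vsort_iter L k : sort_state L sh -> k <= #|` sh| ->
  let y := iter k vsort_step (L, sh) in
  [/\ sort_state y.1 y.2, ends_apart y.1 y.2, #|` y.2| + k = #|` sh|,
      iter k msort_step (swap_parts y) = (L, fset0) & wt y.1 = wt L].
Proof.
move=> g; elim: k => [_|k IH kN] /=.
  split=> //=; [|by rewrite addn0|by rewrite /swap_parts /= fsetDv].
  by move=> u v _ []; rewrite fsetDv.
have [gy cy Ny Ey wy] := IH (ltnW kN).
have y0 : (iter k vsort_step (L, sh)).2 != fset0.
  by rewrite -cardfs_gt0; nat_lia.
have [g' c' N' E' w'] := vsort_step_state gy cy y0; split=> //.
- by rewrite -Ny -N' addSnnS.
- by rewrite -iterS iterSr E'.
- by rewrite w'.
Qed.

Lemma msort_iter S k : sort_state S fset0 -> k <= #|` sh| ->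
  exists y, [/\ iter k msort_step (S, sh) = swap_parts y, sort_state y.1 y.2,
    ends_apart y.1 y.2, #|` sh `\` y.2| + k = #|` sh| &
    iter k vsort_step y = (S, fset0)].
Proof.
move=> g; elim: k => [_|k IH kN].
  exists (S, fset0); split=> //=; first by rewrite /swap_parts /= fsetD0.
    by move=> u v [].
  by rewrite fsetD0 addn0.
have [y [Ey gy cy Ny Vy]] := IH (ltnW kN).
have y0 : sh `\` y.2 != fset0 by rewrite -cardfs_gt0; nat_lia.
have [z [Ez gz cz Nz Vz]] := msort_step_state gy cy y0; exists z; split=> //.
- by rewrite iterS Ey.
- by rewrite -Ny -Nz addSnnS.
- by rewrite iterSr Vz.
Qed.

Lemma vsort_state L : sort_state L sh -> let T := vsort L in
  [/\ sort_state T fset0, msort T = L & wt T = wt L].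
Proof.
move=> g T; have [g' _ N E w] := vsort_iter g (leqnn _).
have ET : T = (iter #|` sh| vsort_step (L, sh)).1
  by rewrite /T /vsort (state_dom g).
set y := iter _ _ _ in g' N E w ET.
have y0 : y.2 = fset0 by apply: cardfs0_eq; nat_lia.
rewrite ET; split=> //; first by rewrite -y0.
by rewrite /msort (state_dom g'); move: E; rewrite /swap_parts y0 fsetD0 => ->.
Qed.

Lemma msort_state S : sort_state S fset0 -> let T := msort S in
  sort_state T sh /\ vsort T = S.
Proof.
move=> g T; have [y [E g' _ N V]] := msort_iter g (leqnn _).
have y0 : sh `\` y.2 = fset0 by apply: cardfs0_eq; nat_lia.
have y2 : y.2 = sh by rewrite -(fsetDDK (state_sub g')) y0 fsetD0.
have ET : T = y.1 by rewrite /T /msort (state_dom g) E.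
rewrite ET -{1}y2; split=> //.
by rewrite /vsort (state_dom g'); move: V;
  rewrite {1}[y]surjective_pairing y2 => ->.
Qed.

End Sorting.

(** * Skew shapes and the bijection *)

Lemma in_diagram la (c : cell) : (c \in diagram la) =
  [&& 0 < c.1, 0 < c.2, c.1 <= size la & c.2 <= nth 0 la c.1.-1].
Proof.
rewrite /diagram inE; apply/allpairsPdep/idP => [[i [j [+ + ->]]]|].
  by rewrite !mem_iota /=; nat_lia.
case: c => [[|i] [|j]] //= /andP[ci cj]; exists i, j.
by rewrite !mem_iota.
Qed.

Lemma diagram_down la (c d : cell) : is_partition la ->
  0 < c.1 -> 0 < c.2 -> cell_le c d -> d \in diagram la -> c \in diagram la.
Proof.
move=> /andP[srt _] c1 c2 /andP[cd1 cd2]; rewrite !in_diagram c1 c2 /=.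
move=> /and4P[d1 d2 ds dn]; apply/andP; split; first exact: leq_trans ds.
apply: leq_trans (leq_trans cd2 dn) _.
have tr : transitive geq by move=> x y z; rewrite /geq /= => h1 h2;
  exact: leq_trans h1.
have rf : reflexive geq by move=> x; rewrite /geq /=.
by apply: (sorted_leq_nth tr rf 0 srt); rewrite ?inE; nat_lia.
Qed.

Lemma skew_pos la mu (c : cell) : c \in skew_shape la mu ->
  (0 < c.1) && (0 < c.2).
Proof. by rewrite in_fsetD !in_diagram => /andP[_ /and4P[-> ->]]. Qed.

Lemma skew_conv la mu : is_partition la -> is_partition mu ->
  forall c e d : cell, c \in skew_shape la mu -> d \in skew_shape la mu ->
  cell_le c e -> cell_le e d -> e \in skew_shape la mu.
Proof.
move=> hla hmu c e d cs ds ce ed; have /andP[c1 c2] := skew_pos cs.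
move: cs ds; rewrite !in_fsetD => /andP[cmu _] /andP[_ dla].
have [e1 e2] : 0 < e.1 /\ 0 < e.2 by move: ce; rewrite /cell_le; lia.
rewrite (diagram_down hla e1 e2 ed dla) andbT.
by apply: contra cmu; apply: diagram_down.
Qed.

Section Chain.
Variable sh : {fset cell}.
Hypothesis sh_conv : forall c e d : cell, c \in sh -> d \in sh ->
  cell_le c e -> cell_le e d -> e \in sh.

(** In a convex shape comparable cells are joined by a lattice path, so
    conditions on neighbours extend to all comparable cells. *)
Lemma cell_le_chain (R : cell -> cell -> Prop) :
  (forall c, R c c) ->
  (forall c d e, cell_le c d -> cell_le d e -> R c d -> R d e -> R c e) ->
  (forall c, c \in sh -> rt c \in sh -> R c (rt c)) ->
  (forall c, c \in sh -> dn c \in sh -> R c (dn c)) ->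
  forall c d : cell, c \in sh -> d \in sh -> cell_le c d -> R c d.
Proof.
move=> rf tr Rr Rd c d;
  move: {2}(d.1 - c.1 + (d.2 - c.2)) (leqnn (d.1 - c.1 + (d.2 - c.2))).
move=> N; elim: N c => [|N IH] c hN cs ds cd.
  suff -> : c = d by [].
  by case: c d hN cd {cs ds} => [i j] [k l] /=; rewrite /cell_le /= => *;
    congr pair; lia.
have [lt|ge] := ltnP c.2 d.2.
  have [Rs RD] := rtP sh_conv cs ds cd lt.
  apply: (tr c (rt c) d) => //; first by rewrite /cell_le /= leqnn leqnSn.
    exact: Rr.
  by apply: IH => //=; move: hN lt => /=; nat_lia.
have [lt|ge1] := ltnP c.1 d.1.
  have [Ds DD] := dnP sh_conv cs ds cd lt.
  apply: (tr c (dn c) d) => //; first by rewrite /cell_le /= leqnn leqnSn.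
    exact: Rd.
  by apply: IH => //=; move: hN lt => /=; nat_lia.
by apply: IH => //; nat_lia.
Qed.

Lemma LHT_state n L : LHT n sh L -> sort_state sh n L sh.
Proof.
case=> dL bL rL cL; have fL c : c \in sh ->
  L.[? c] = Some ((ent L c).1, (ent L c).2).
  by move=> cs; rewrite ent_fnd ?dL // -surjective_pairing.
split=> //; rewrite ?fsetDv //.
- by move=> [i j] cs; have := bL _ _ _ _ (fL _ cs); rewrite /cvalue /=; nat_lia.
- apply: cell_le_chain.
  + by move=> c; split; [exact: entry_lexx|rewrite ltnn].
  + move=> c d e /andP[cd _] /andP[de _] [l1 s1] [l2 s2].
    split; first exact: entry_le_trans l2 l1.
    move=> lt E; have E1 : ent L d = ent L e by apply: entry_le_anti => //;
      rewrite -E.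
    have E2 : ent L c = ent L d by rewrite E1.
    have [h|h] := ltnP c.1 d.1; first exact: s1 h E2.
    by apply: s2 E1; exact: leq_ltn_trans lt.
  + move=> [i j] cs rs; split; last by rewrite /= ltnn.
    have := rL _ _ _ _ _ _ (fL _ cs) (fL _ rs); rewrite /entry_le /rt /=.
    case=> [lt|[-> le]]; last by rewrite leooxx eqxx.
    have le : leoo (ent L (i, j.+1)).2 (ent L (i, j)).2.
      have := leoo_total (ent L (i, j.+1)).2 (ent L (i, j)).2.
      by move: lt; rewrite /ltoo => /negPf ->; rewrite orbF.
    rewrite le /=; apply/implyP=> /eqP E.
    by move: lt; rewrite E /ltoo leooxx.
  + move=> [i j] cs rs.
    have := cL _ _ _ _ _ _ (fL _ cs) (fL _ rs);
      rewrite /lht_rel /entry_le /dn /=.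
    case=> [lt|[E lt]].
      have le : leoo (ent L (i.+1, j)).2 (ent L (i, j)).2.
        have := leoo_total (ent L (i.+1, j)).2 (ent L (i, j)).2.
        by move: lt; rewrite /ltoo => /negPf ->; rewrite orbF.
      rewrite le /=; split.
        by apply/implyP=> /eqP E; move: lt; rewrite E /ltoo leooxx.
      by move=> _ E; move: lt; rewrite E /ltoo leooxx.
    rewrite E leooxx eqxx (ltnW lt); split=> // _ E2.
    by move: lt; rewrite E2 ltnn.
Qed.

Lemma state_LHT n L : sort_state sh n L sh -> LHT n sh L.
Proof.
move=> g; have dL := state_dom g.
have fL c e : L.[? c] = Some e -> c \in sh /\ ent L c = e.
  by move=> h; rewrite -dL (fnd_in h) /ent h.
split=> //.
- move=> i j a r /fL[cs E]; have := state_bound g cs; rewrite /cvalue E /=;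
  nat_lia.
- move=> i j a r b s /fL[cs E] /fL[ds E2].
  have [|l _] := state_lht g cs ds; first by rewrite /cell_le /= leqnn leqnSn.
  move: l; rewrite E E2 /entry_le /ltoo /= => /andP[le].
  have [->|ne] := eqVneq s r => /= h; first by right.
  left; apply/negP=> h2; case/negP: ne; apply/eqP; exact: leoo_anti.
- move=> i j a r b s /fL[cs E] /fL[ds E2].
  have [|l st] := state_lht g cs ds; first by rewrite /cell_le /= leqnn leqnSn.
  move: l st; rewrite E E2 /entry_le /ltoo /= => /andP[le].
  have [->|ne] := eqVneq s r => /= h st; last first.
    by left; apply/negP=> h2; case/negP: ne; apply/eqP; exact: leoo_anti.
  right; split=> //; rewrite ltn_neqAle h andbT; apply/eqP=> Eb.
  by case: (st (leqnn _)); rewrite Eb.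
Qed.

Lemma SSCT_state n S : SSCT n sh S -> sort_state sh n S fset0.
Proof.
case=> dL bL rL cL; have fL c : c \in sh ->
  S.[? c] = Some ((ent S c).1, (ent S c).2).
  by move=> cs; rewrite ent_fnd ?dL // -surjective_pairing.
split=> //; rewrite ?fsetD0 //.
- by split=> c d.
- apply: (cell_le_chain (R := ssct_rel (cvalue S))).
  + by move=> c; split=> //; rewrite ltnn.
  + by move=> c d e; apply: ssct_rel_trans.
  + move=> [i j] cs rs; have := rL _ _ _ _ _ _ (fL _ cs) (fL _ rs).
    by rewrite /ssct_rel /cvalue /rt /=; nat_lia.
  + move=> [i j] cs rs; have := cL _ _ _ _ _ _ (fL _ cs) (fL _ rs).
    by rewrite /ssct_rel /cvalue /dn /=; nat_lia.
- by move=> [i j] cs; have := bL _ _ _ _ (fL _ cs); rewrite /cvalue /=; nat_lia.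
Qed.

Lemma state_SSCT n S : sort_state sh n S fset0 -> SSCT n sh S.
Proof.
move=> g; have dL := state_dom g.
have fL c e : S.[? c] = Some e -> c \in sh /\ ent S c = e.
  by move=> h; rewrite -dL (fnd_in h) /ent h.
have gr := state_ssct g; rewrite fsetD0 in gr.
split=> //.
- move=> i j a r /fL[cs E]; have := state_bound g cs; rewrite /cvalue E /=;
  nat_lia.
- move=> i j a r b s /fL[cs E] /fL[ds E2].
  have := gr _ _ cs ds; rewrite /ssct_rel /cvalue /cell_le E E2 /=; nat_lia.
- move=> i j a r b s /fL[cs E] /fL[ds E2].
  have := gr _ _ cs ds; rewrite /ssct_rel /cvalue /cell_le E E2 /=; nat_lia.
Qed.

End Chain.

Theorem theorem4p10 (la mu : seq nat) (n : nat)
    (hla : is_partition la) (hmu : is_partition mu)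
    (hsub : (diagram mu `<=` diagram la)%fset) (hn : (0 < n)%N) :
  let alpha := skew_shape la mu in
  [/\ forall L : tableau, LHT n alpha L -> SSCT n alpha (vsort L),
      forall S : tableau, SSCT n alpha S -> LHT n alpha (msort S),
      forall L : tableau, LHT n alpha L -> msort (vsort L) = L,
      forall S : tableau, SSCT n alpha S -> vsort (msort S) = S
    & forall L : tableau, LHT n alpha L -> wt (vsort L) = wt L].
Proof.
move=> alpha; have conv := skew_conv hla hmu.
have pos := @skew_pos la mu; rewrite -/alpha in conv pos.
split=> T.
- by move=> /(LHT_state conv) /(vsort_state conv pos) [/state_SSCT].
- by move=> /(SSCT_state conv) /(msort_state conv pos) [/state_LHT].
- by move=> /(LHT_state conv) /(vsort_state conv pos) [].
- by move=> /(SSCT_state conv) /(msort_state conv pos) [].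
- by move=> /(LHT_state conv) /(vsort_state conv pos) [].
Qed.
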